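(* Every three-dimensional proper (i.e. non-symmetric) generalized symmetric space is a Ricci soliton. More precisely, let $\varepsilon\in\{1,-1\}$, let $\mu\neq 0$ be a real constant, and let $g$ be the pseudo-Riemannian metric $$g=\varepsilon\left(e^{2t}\,dx^{2}+e^{-2t}\,dy^{2}\right)+\mu\,dt^{2}$$ on $\mathbb{R}^{3}$ with global coordinates $(x,y,t)$. Then for all real constants $A_{1},A_{2},A_{3}$ the vector field $$X=\left(A_{1}-\left(A_{3}+\frac{1}{\mu}\right)x\right)\frac{\partial}{\partial x}+\left(A_{2}+\left(A_{3}-\frac{1}{\mu}\right)y\right)\frac{\partial}{\partial y}+A_{3}\frac{\partial}{\partial t}$$ satisfies the Ricci soliton equation $\mathcal{L}_{X}g+\varrho=\lambda g$ for some real constant $\lambda$, where $\varrho$ is the Ricci tensor of $g$. This Ricci soliton is not a gradient one: there is no smooth function $f\colon\mathbb{R}^{3}\to\mathbb{R}$ with $X=\mathrm{grad}_g(f)$.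
   Context: Let $(M,g)$ be a pseudo-Riemannian manifold. An $s$-structure on $M$ is a family of isometries $\{s_{p} : p\in M\}$ of $(M,g)$ such that each $s_{p}$ has $p$ as an isolated fixed point. It is regular if the map $(p,q)\mapsto s_{p}(q)$ is smooth and $s_{p}\circ s_{q}=s_{\tilde q}\circ s_{p}$ with $\tilde q=s_{p}(q)$, for all $p,q\in M$. A generalized symmetric space is a pseudo-Riemannian manifold admitting at least one regular $s$-structure; it is proper if it is not symmetric. By the known classification of Černý and Kowalski (which may be used), any proper three-dimensional generalized symmetric space is given by $\mathbb{R}^{3}(x,y,t)$ with the metric $\varepsilon(e^{2t}dx^{2}+e^{-2t}dy^{2})+\mu\,dt^{2}$ for some $\varepsilon=\pm1$ and some real constant $\mu\neq0$. A Ricci soliton is a pseudo-Riemannian manifold $(M,g)$ together with a smooth vector field $X$ such that $\mathcal{L}_{X}g+\varrho=\lambda g$ for some real number $\lambda$, where $\mathcal{L}_{X}$ is the Lie derivative and $\varrho$ is the Ricci tensor. It is a gradient Ricci soliton if $X$ is the gradient (with respect to $g$) of some smooth function $f\colon M\to\mathbb{R}$. Sign conventions: $R(X,Y)=\nabla_{X}\nabla_{Y}-\nabla_{Y}\nabla_{X}-\nabla_{[X,Y]}$, with $\nabla$ the Levi-Civita connection, and $\varrho(X,Y)=\mathrm{tr}(Z\mapsto R(Z,X)Y)$. *)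

(* Defs.v *)
From HB Require Import structures.
From mathcomp Require Import all_boot all_order all_algebra.
From mathcomp Require Import all_classical all_reals all_analysis.
From mathcomp Require Import lra.
Set Implicit Arguments.
Unset Strict Implicit.
Unset Printing Implicit Defensive.
Import Order.TTheory GRing.Theory Num.Theory.
Import numFieldNormedType.Exports.
Local Open Scope classical_set_scope.
Local Open Scope ring_scope.

(* Smoothness on a set [U], which is open in every use below.  On
   finite-dimensional spaces, f is C^(k+1) iff it is (Frechet) differentiable
   and all its directional derivatives are C^k. *)
Fixpoint Ck_on (R : realType) (V W : normedModType R) (k : nat)
    (U : set V) (f : V -> W) : Prop :=
  match k with
  | 0 => forall x, U x -> {for x, continuous f}
  | k'.+1 => (forall x, U x -> differentiable f x) /\
             (forall v : V, Ck_on k' U (fun x => 'D_v f x))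
  end.

Definition smooth_on (R : realType) (V W : normedModType R)
    (U : set V) (f : V -> W) : Prop := forall k, Ck_on k U f.

(* Tensor calculus in a coordinate system (x^0, x^1, x^2).  Points and tangent
   vectors are row vectors; a metric is given by its matrix of components
   g_ij = g(d/dx^i, d/dx^j). *)

Notation coords R := 'rV[R]_3 (only parsing).
Notation vfield R := ('rV[R]_3 -> 'rV[R]_3) (only parsing).
Notation metric_field R := ('rV[R]_3 -> 'M[R]_3) (only parsing).

Definition e_ (R : realType) (i : 'I_3) : coords R := delta_mx 0 i.

Definition frame (R : realType) (i : 'I_3) : vfield R := fun=> e_ R i.

Definition pairing (R : realType) (g : metric_field R) (X Y : vfield R)
    (p : coords R) : R := (X p *m g p *m (Y p)^T) 0 0.

Definition bracket (R : realType) (X Y : vfield R) : vfield R :=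
  fun p => 'D_(X p) Y p - 'D_(Y p) X p.

(* Gamma^k_ij of the Levi-Civita connection; torsion-freeness and metric
   compatibility are [christoffelC] and [derive_metric] below. *)
Definition christoffel (R : realType) (g : metric_field R) (k i j : 'I_3)
    (p : coords R) : R :=
  2^-1 * \sum_(l < 3) invmx (g p) k l *
    ('D_(e_ R i) (fun q => g q j l) p + 'D_(e_ R j) (fun q => g q i l) p
     - 'D_(e_ R l) (fun q => g q i j) p).

Lemma christoffelC (R : realType) (g : metric_field R) (k i j : 'I_3)
    (p : coords R) :
  (forall q, (g q)^T = g q) -> christoffel g k i j p = christoffel g k j i p.
Proof.
move=> gT; congr (_ * _); apply: eq_bigr => l _; congr (_ * _).
rewrite [X in X - _]addrC; congr (_ - 'D_(e_ R l) _ p).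
by apply/funext => q; rewrite -[in LHS](gT q) mxE.
Qed.

Lemma derive_metric (R : realType) (g : metric_field R) (k i j : 'I_3)
    (p : coords R) :
  (forall q, (g q)^T = g q) -> g p \in unitmx ->
  'D_(e_ R k) (fun q => g q i j) p =
    \sum_(l < 3) (christoffel g l k i p * g p l j
                  + christoffel g l k j p * g p i l).
Proof.
move=> gT gU.
have gC q a b : g q a b = g q b a by rewrite -[in LHS](gT q) mxE.
have giT : (invmx (g p))^T = invmx (g p) by rewrite trmx_inv gT.
have lower a b c : \sum_(l < 3) christoffel g l a b p * g p l c =
    2^-1 * ('D_(e_ R a) (fun q => g q b c) p + 'D_(e_ R b) (fun q => g q a c) p
     - 'D_(e_ R c) (fun q => g q a b) p).
  pose w := \row_m ('D_(e_ R a) (fun q => g q b m) p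
    + 'D_(e_ R b) (fun q => g q a m) p - 'D_(e_ R m) (fun q => g q a b) p).
  transitivity (2^-1 * (w *m invmx (g p) *m g p) 0 c); last first.
    by rewrite mulmxKV// mxE.
  rewrite [in RHS]mxE mulr_sumr; apply: eq_bigr => l _.
  rewrite /christoffel -mulrA; congr (_ * (_ * _)).
  rewrite mxE; apply: eq_bigr => m _.
  by rewrite [w 0 m]mxE mulrC -[in LHS]giT mxE.
rewrite big_split/= lower.
under eq_bigr do rewrite (gC p i).
rewrite lower.
have -> : (fun q => g q j i) = (fun q => g q i j) by apply/funext => q.
have -> : (fun q => g q k j) = (fun q => g q j k) by apply/funext => q.
have -> : (fun q => g q k i) = (fun q => g q i k) by apply/funext => q.
lra.
Qed.

Definition nabla (R : realType) (g : metric_field R) (X Y : vfield R) :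
    vfield R :=
  fun p => 'D_(X p) Y p +
    \row_k \sum_(i < 3) \sum_(j < 3) christoffel g k i j p * X p 0 i * Y p 0 j.

Definition curvature (R : realType) (g : metric_field R) (X Y Z : vfield R) :
    vfield R :=
  fun p => nabla g X (nabla g Y Z) p - nabla g Y (nabla g X Z) p
           - nabla g (bracket X Y) Z p.

(* Row k of the matrix below is the image of d/dx^k under Z |-> R(Z,X)Y. *)
Definition ricci (R : realType) (g : metric_field R) (X Y : vfield R)
    (p : coords R) : R :=
  \tr (\matrix_(k < 3) curvature g (@frame R k) X Y p).

Definition lie_metric (R : realType) (g : metric_field R) (X Y Z : vfield R)
    (p : coords R) : R :=
  'D_(X p) (pairing g Y Z) p - pairing g (bracket X Y) Z p
  - pairing g Y (bracket X Z) p.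

(* L_X g + ric = lambda g at p, on the coordinate frame. *)
Definition soliton_eq (R : realType) (g : metric_field R) (X : vfield R)
    (lambda : R) (p : coords R) : Prop :=
  forall i j : 'I_3,
    lie_metric g X (@frame R i) (@frame R j) p
      + ricci g (@frame R i) (@frame R j) p
    = lambda * g p i j.

(* (grad f)^k = \sum_i (d_i f) g^ik *)
Definition grad (R : realType) (g : metric_field R) (f : coords R -> R) :
    vfield R :=
  fun p => (\row_i 'D_(e_ R i) f p) *m invmx (g p).

(* [cmap] and [cinv] are total functions, meaningful on [cdom] and [cimg]
   only. *)

Record chart (R : realType) (M : topologicalType) : Type := Chart {
  cdom : set M;
  cimg : set 'rV[R]_3;
  cmap : M -> 'rV[R]_3;
  cinv : 'rV[R]_3 -> M;
  cdom_open : open cdom;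
  cimg_open : open cimg;
  cmap_in : forall p, cdom p -> cimg (cmap p);
  cinv_in : forall x, cimg x -> cdom (cinv x);
  cmapK : forall p, cdom p -> cinv (cmap p) = p;
  cinvK : forall x, cimg x -> cmap (cinv x) = x;
  cmap_cont : {within cdom, continuous cmap};
  cinv_cont : {within cimg, continuous cinv}
}.

(* Local expression of F : M -> M in the charts c (source) and c' (target);
   for F = id this is the change of coordinates from c to c'. *)
Definition local_rep (R : realType) (M : topologicalType) (F : M -> M)
    (c c' : chart R M) : 'rV[R]_3 -> 'rV[R]_3 :=
  fun x => cmap c' (F (cinv c x)).

Definition local_dom (R : realType) (M : topologicalType) (F : M -> M)
    (c c' : chart R M) : set 'rV[R]_3 :=
  [set x | cimg c x /\ cdom c' (F (cinv c x))].

Definition compatible (R : realType) (M : topologicalType)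
    (c c' : chart R M) : Prop :=
  smooth_on (local_dom id c c') (local_rep id c c') /\
  smooth_on (local_dom id c' c) (local_rep id c' c).

(* Manifolds are connected; [atlas] is the maximal atlas. *)
Record manifold3 (R : realType) : Type := Manifold3 {
  carrier :> topologicalType;
  atlas : set (chart R carrier);
  carrier_hausdorff : hausdorff_space carrier;
  carrier_countable : @second_countable carrier;
  carrier_connected : connected [set: carrier];
  atlas_cover : forall p, exists c, atlas c /\ cdom c p;
  atlas_compatible : forall c c', atlas c -> atlas c' -> compatible c c';
  atlas_maximal : forall c,
    (forall c', atlas c' -> compatible c c') -> atlas c
}.

(* With row vectors, dF maps v to v *m 'J F; hence F^*g has matrix
   J *m g *m J^T.  [local_metric_pullback F c c' g g'] says that F^*g' = g. *)
Definition local_metric_pullback (R : realType) (M : topologicalType)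
    (F : M -> M) (c c' : chart R M) (g g' : metric_field R) : Prop :=
  forall x, local_dom F c c' x ->
    g x = 'J (local_rep F c c') x *m g' (local_rep F c c' x)
          *m ('J (local_rep F c c') x)^T.

Record pseudo_riemannian3 (R : realType) : Type := PseudoRiemannian3 {
  underlying :> manifold3 R;
  metric : chart R underlying -> 'rV[R]_3 -> 'M[R]_3;
  metric_smooth : forall c, atlas c -> smooth_on (cimg c) (metric c);
  metric_sym : forall c x, atlas c -> cimg c x -> (metric c x)^T = metric c x;
  metric_nondegenerate : forall c x,
    atlas c -> cimg c x -> metric c x \in unitmx;
  metric_compatible : forall c c', atlas c -> atlas c' ->
    local_metric_pullback id c c' (metric c) (metric c')
}.

Definition smooth_map (R : realType) (M : manifold3 R) (F : M -> M) : Prop :=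
  continuous F /\
  forall c c' : chart R M, atlas c -> atlas c' ->
    smooth_on (local_dom F c c') (local_rep F c c').

Definition smooth_map2 (R : realType) (M : manifold3 R)
    (F : M -> M -> M) : Prop :=
  continuous (fun pq : M * M => F pq.1 pq.2) /\
  forall c1 c2 c : chart R M, atlas c1 -> atlas c2 -> atlas c ->
    smooth_on
      [set z : 'rV[R]_3 * 'rV[R]_3 |
        [/\ cimg c1 z.1, cimg c2 z.2 &
            cdom c (F (cinv c1 z.1) (cinv c2 z.2))]]
      (fun z : 'rV[R]_3 * 'rV[R]_3 => cmap c (F (cinv c1 z.1) (cinv c2 z.2))).

Definition isometry (R : realType) (M : pseudo_riemannian3 R)
    (F : M -> M) : Prop :=
  [/\ smooth_map F,
      exists G : M -> M, [/\ smooth_map G, cancel F G & cancel G F] &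
      forall c c' : chart R M, atlas c -> atlas c' ->
        local_metric_pullback F c c' (metric c) (metric c')].

Definition isolated_fixpoint (M : topologicalType) (F : M -> M) (p : M) :
    Prop :=
  F p = p /\ (\forall q \near p, F q = q -> q = p).

Definition s_structure (R : realType) (M : pseudo_riemannian3 R)
    (s : M -> M -> M) : Prop :=
  forall p, isometry (s p) /\ isolated_fixpoint (s p) p.

Definition regular_s_structure (R : realType) (M : pseudo_riemannian3 R)
    (s : M -> M -> M) : Prop :=
  [/\ s_structure s, smooth_map2 s &
      forall p q, s p \o s q = s (s p q) \o s p].

Definition generalized_symmetric (R : realType) (M : pseudo_riemannian3 R) :
    Prop := exists s : M -> M -> M, regular_s_structure s.

(* Symmetric spaces are those whose symmetries have order two. *)
Definition symmetric_space (R : realType) (M : pseudo_riemannian3 R) : Prop :=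
  forall p : M, exists F : M -> M,
    [/\ isometry F, involutive F & isolated_fixpoint F p].

Definition proper_generalized_symmetric (R : realType)
    (M : pseudo_riemannian3 R) : Prop :=
  generalized_symmetric M /\ ~ symmetric_space M.

(* Components of a smooth vector field in all the charts. *)
Definition vector_field (R : realType) (M : manifold3 R)
    (X : chart R M -> 'rV[R]_3 -> 'rV[R]_3) : Prop :=
  (forall c, atlas c -> smooth_on (cimg c) (X c)) /\
  (forall c c', atlas c -> atlas c' -> forall x, local_dom id c c' x ->
    X c' (local_rep id c c' x) = X c x *m 'J (local_rep id c c') x).

Definition ricci_soliton (R : realType) (M : pseudo_riemannian3 R) : Prop :=
  exists X : chart R M -> 'rV[R]_3 -> 'rV[R]_3, vector_field X /\
  exists lambda : R, forall c x, atlas c -> cimg c x ->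
    soliton_eq (metric c) (X c) lambda x.

(* The metric eps (e^{2t} dx^2 + e^{-2t} dy^2) + mu dt^2, with
   (x, y, t) = (p 0 0, p 0 1, p 0 2). *)
Definition gs_metric (R : realType) (eps mu : R) : metric_field R :=
  fun p => diag_mx (\row_(i < 3)
    [:: eps * expR (2 * p 0 2); eps * expR (- (2 * p 0 2)); mu]`_i).

(* Cerny-Kowalski: every proper three-dimensional generalized symmetric space
   has a global chart onto R^3 in which its metric is [gs_metric eps mu]. *)
Definition cerny_kowalski_classification (R : realType) : Prop :=
  forall M : pseudo_riemannian3 R, proper_generalized_symmetric M ->
  exists eps mu : R, [/\ eps = 1 \/ eps = -1, mu != 0 &
    exists c : chart R M,
      [/\ atlas c, cdom c = setT, cimg c = setT &
          forall x, metric c x = gs_metric eps mu x]].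

Definition gs_field (R : realType) (mu A1 A2 A3 : R) : vfield R :=
  fun p => \row_(i < 3)
    [:: A1 - (A3 + mu^-1) * p 0 0; A2 + (A3 - mu^-1) * p 0 1; A3]`_i.

(* Main.v *)
Require Import Defs.
From HB Require Import structures.
From mathcomp Require Import all_boot all_order all_algebra.
From mathcomp Require Import all_classical all_reals all_analysis.
From mathcomp Require Import ring lra.
Set Implicit Arguments.
Unset Strict Implicit.
Unset Printing Implicit Defensive.
Import Order.TTheory GRing.Theory Num.Theory.
Import numFieldNormedType.Exports.
Local Open Scope classical_set_scope.
Local Open Scope ring_scope.

(* In the global coordinates the Levi-Civita connection is guessed and verified
   (a torsion-free metric connection is unique); its only nonzero Ricci component
   is ric(dt, dt) = -2, so that X solves the soliton equation with
   lambda = -2 / mu.  If X = grad f, then df/dt = mu A3 is constant, hence df/dx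
   and df/dy do not depend on t; as they are e^(2t) and e^(-2t) times
   a function of (x, y), X^0 and X^1 vanish, whence A3 + 1/mu = A3 - 1/mu = 0.

   On a manifold the field is given in the other charts by the change of
   coordinates phi to the global chart, with Jacobian J.  Uniqueness of the
   Levi-Civita connection shows that its matrices change as
   Gamma_i J = D_i J + J A_i, where A is the pullback by phi; symmetry of the
   second derivatives of phi and of J then removes all derivatives of J from the
   curvature and from the Lie derivative of the metric, so that both transform
   as tensors. *)

(** * Differentiability and the classes C^k *)

Section Derivatives.
Context {R : realType} {V : normedModType R}.

Lemma is_derive_mxP m n (F : V -> 'M[R]_(m, n)) x v dF :
  is_derive x v F dF <->
  forall i j, is_derive x v (fun y => F y i j) (dF i j).
Proof.
split=> [[Fx <-] i j|FE].
  by rewrite derive_mx// mxE; apply/derivableP; move/derivable_mxP : Fx.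
have Fx : derivable F x v by apply/derivable_mxP => i j; case: (FE i j).
apply: DeriveDef => //; rewrite derive_mx//.
by apply/matrixP => i j; rewrite mxE; case: (FE i j).
Qed.

Lemma is_derive_sum_fun n (h : 'I_n -> V -> R) (x v : V) (dh : 'I_n -> R) :
  (forall i, is_derive x v (h i) (dh i)) ->
  is_derive x v (fun y => \sum_(i < n) h i y) (\sum_(i < n) dh i).
Proof.
move=> H; have -> : (fun y => \sum_(i < n) h i y) = \sum_(i < n) h i.
  by apply/funext => y; rewrite fct_sumE.
exact: is_derive_sum.
Qed.

Lemma is_derive_mulmx m n p (F : V -> 'M[R]_(m, n)) (G : V -> 'M[R]_(n, p))
    x v dF dG : is_derive x v F dF -> is_derive x v G dG ->
  is_derive x v (fun y => F y *m G y) (dF *m G x + F x *m dG).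
Proof.
move=> /is_derive_mxP HF /is_derive_mxP HG; apply/is_derive_mxP => i j.
have -> : (fun y => (F y *m G y) i j) =
          (fun y => \sum_k (fun z => F z i k) y * (fun z => G z k j) y).
  by apply/funext => y; rewrite mxE.
rewrite !mxE -big_split/=; apply: is_derive_sum_fun => k.
have := is_deriveM (HF i k) (HG k j).
by rewrite addrC/= [_ *: dF i k]mulrC.
Qed.

Lemma is_derive_trmx m n (F : V -> 'M[R]_(m, n)) x v dF :
  is_derive x v F dF -> is_derive x v (fun y => (F y)^T) dF^T.
Proof.
move=> /is_derive_mxP HF; apply/is_derive_mxP => i j; rewrite mxE.
by have -> : (fun y => (F y)^T i j) = (fun y => F y j i)
  by apply/funext => y; rewrite mxE.
Qed.

Lemma is_derive_diff (W : normedModType R) (f : V -> W) x v :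
  differentiable f x -> is_derive x v f ('D_v f x).
Proof. by move=> /diff_derivable H; exact/derivableP. Qed.

Lemma is_derive_chain (U W : normedModType R) (phi : V -> U) (f : U -> W) x v :
  differentiable phi x -> differentiable f (phi x) ->
  is_derive x v (fun y => f (phi y)) ('D_('D_v phi x) f (phi x)).
Proof.
move=> dphi df; have H := differentiable_comp dphi df.
have -> : 'D_('D_v phi x) f (phi x) = 'D_v (f \o phi) x.
  by rewrite !deriveE// (diff_comp dphi df).
exact: (derivableP (diff_derivable H)).
Qed.

End Derivatives.

Lemma derive_rowE (R : realType) n (W : normedModType R)
    (f : 'rV[R]_n -> W) (x v : 'rV[R]_n) :
  differentiable f x ->
  'D_v f x = \sum_i v 0 i *: 'D_(delta_mx 0 i) f x.
Proof.
move=> df; rewrite deriveE// {1}[v]row_sum_delta linear_sum.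
by apply: eq_bigr => i _; rewrite linearZ deriveE.
Qed.

(** Write [g] as [(g - f) + f]: the first summand vanishes near [x], so its differential is zero. *)
Lemma near_eq_differentiable (R : realType) (V W : normedModType R)
    (f g : V -> W) x :
  {near x, f =1 g} -> differentiable f x -> differentiable g x.
Proof.
move=> fg df; rewrite -[g](subrK f); apply: differentiableD => //.
apply/diffP => /=.
(* The differential is a chosen map, so it suffices to exhibit one continuous linear map with the
   required expansion; the zero map serves. *)
apply: (@getPex _ (fun df : {linear V -> W} => continuous df /\
  forall y, (g - f) y = (g - f) (lim (nbhs x)) + df (y - lim (nbhs x))
                  +o_(y \near x) (y - lim (nbhs x)))).
exists (\0 : {linear V -> W}); split; first exact: cst_continuous.
have gf0 : (g - f) x = 0 by rewrite /= !fctE (nbhs_singleton fg) subrr.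
move=> y; rewrite lim_id// gf0 add0r /=; move: y; apply/funeqP.
apply/eqaddoP => e e0; near=> y.
rewrite /= !fctE subr0 (near fg y)// subrr normr0 mulr_ge0// ltW.
Unshelve. all: by end_near. Qed.

Lemma open_near (T : topologicalType) (U : set T) (P : set T) x :
  open U -> U x -> (forall y, U y -> P y) -> \forall y \near x, P y.
Proof.
by move=> oU Ux UP; have : nbhs x U by [exact: open_nbhs_nbhs]; exact: filterS.
Qed.

(** * Closure properties of the classes C^k *)

Section Ck.
Context {R : realType}.
Implicit Types (V W : normedModType R).

(** Openness turns equality on [U] into equality near each point, so directional derivatives agree
    on [U] as well and the induction goes through. *)
Lemma eq_Ck_on V W k (U : set V) (f g : V -> W) : open U ->
  (forall x, U x -> f x = g x) -> Ck_on k U f -> Ck_on k U g.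
Proof.
move=> oU; elim: k => [|k IH] in f g * => fg.
  move=> fc x Ux; have := fc x Ux; rewrite /prop_for /continuous_at -(fg x)//.
  by apply: cvg_trans; apply: near_eq_cvg; apply: open_near Ux _.
move=> [fd fC]; split=> [x Ux|v].
  by apply: near_eq_differentiable (fd x Ux); apply: open_near Ux _.
apply: IH (fC v) => x Ux; apply: near_eq_derive.
exact: open_near Ux _.
Qed.

Lemma Ck_onS V W k (U U' : set V) (f : V -> W) :
  U' `<=` U -> Ck_on k U f -> Ck_on k U' f.
Proof.
move=> UU'; elim: k f => [|k IH] f /=; first by move=> fc x /UU'; exact: fc.
by move=> [fd fC]; split=> [x /UU'|v]; [exact: fd|exact: IH].
Qed.

Lemma Ck_onE V W k (U : set V) (f : V -> W) : Ck_on k.+1 U f ->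
  (forall x, U x -> differentiable f x) /\ forall v, Ck_on k U ('D_v f).
Proof. by []. Qed.

Lemma Ck_on_pred V W k (U : set V) (f : V -> W) : Ck_on k.+1 U f -> Ck_on k U f.
Proof.
elim: k f => [|k IH] f [fd fC]; first by move=> x /fd/differentiable_continuous.
by split=> // v; apply: IH.
Qed.

Lemma Ck_on_cst V W k (U : set V) (a : W) : Ck_on k U (cst a : V -> W).
Proof.
elim: k a => [|k IH] a; first by move=> x _; exact: cst_continuous.
split=> // v; have -> : (fun x => 'D_v (cst a) x) = cst (0 : W).
  by apply/funext => x; rewrite derive_cst.
exact: IH.
Qed.

Lemma Ck_onD V W k (U : set V) (f g : V -> W) : open U ->
  Ck_on k U f -> Ck_on k U g -> Ck_on k U (fun x => f x + g x).
Proof.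
move=> oU; elim: k f g => [|k IH] f g.
  by move=> fc gc x Ux; apply: continuousD; [exact: fc|exact: gc].
move=> [fd fC] [gd gC]; split=> [x Ux|v].
  by apply: differentiableD; [exact: fd|exact: gd].
apply: eq_Ck_on (IH _ _ (fC v) (gC v)) => // x Ux.
by rewrite -deriveD//; apply: diff_derivable; [exact: fd|exact: gd].
Qed.

Lemma Ck_on_sum V W k (U : set V) n (f : 'I_n -> V -> W) : open U ->
  (forall i, Ck_on k U (f i)) -> Ck_on k U (fun x => \sum_i f i x).
Proof.
move=> oU; elim: n f => [|n IH] f fC.
  have -> : (fun x => \sum_i f i x) = cst 0.
    by apply/funext => x; rewrite big_ord0.
  exact: Ck_on_cst.
have -> : (fun x => \sum_i f i x) =
    (fun x => f ord0 x + \sum_(i < n) f (lift ord0 i) x).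
  by apply/funext => x; rewrite big_ord_recl.
by apply: Ck_onD => //; apply: IH => i; exact: fC.
Qed.

Lemma Ck_onM V k (U : set V) (f g : V -> R) : open U ->
  Ck_on k U f -> Ck_on k U g -> Ck_on k U (fun x => f x * g x).
Proof.
move=> oU; elim: k f g => [|k IH] f g fC gC.
  by move=> x Ux; apply: continuousM; [exact: fC|exact: gC].
have [fd fC'] := Ck_onE fC; have [gd gC'] := Ck_onE gC; split=> [x Ux|v].
  by apply: differentiableM; [exact: fd|exact: gd].
apply: (@eq_Ck_on _ _ _ _ (fun x => f x * 'D_v g x + g x * 'D_v f x)) => //.
  move=> x Ux; rewrite -[RHS]/('D_v (f * g) x) deriveM//.
    by apply: diff_derivable; exact: fd.
  by apply: diff_derivable; exact: gd.
(* The Leibniz rule keeps one factor undifferentiated; that factor is lowered by one class. *)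
by apply: Ck_onD => //; apply: IH => //; exact: Ck_on_pred.
Qed.

Lemma differentiable_mxP V m n (F : V -> 'M[R]_(m, n)) x :
  differentiable F x <-> forall i j, differentiable (fun y => F y i j) x.
Proof.
split=> [Fd i j|Fd].
  exact: (differentiable_comp Fd (differentiable_coord _ i j)).
have -> : F = \sum_i \sum_j (fun y => F y i j *: delta_mx i j).
  apply/funext => y; rewrite {1}[F y]matrix_sum_delta fct_sumE.
  by apply: eq_bigr => i _; rewrite fct_sumE.
by apply: differentiable_sum => i; apply: differentiable_sum => j;
   exact: differentiableZl.
Qed.

Lemma Ck_on_mxP V k (U : set V) m n (F : V -> 'M[R]_(m, n)) : open U ->
  Ck_on k U F <-> forall i j, Ck_on k U (fun x => F x i j).
Proof.
move=> oU; elim: k F => [|k IH] F.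
  split=> [Fc i j x Ux|Fc x Ux].
    have := continuous_comp (Fc x Ux) (@coord_continuous _ _ _ i j (F x)).
    exact.
  have {}Fc i j : (F y i j) @[y --> x] --> F x i j by exact: Fc.
  apply/cvgrPdist_le => /= e e0; near=> y.
  (* The matrix norm is the maximum over finitely many entries, so the entrywise estimates hold
     simultaneously near [x]. *)
  rewrite /Num.Def.normr/= mx_normrE (bigmax_le _ (ltW e0))//= => i _.
  rewrite !mxE/=; move: i; near: y; apply: filter_forall => /= i.
  by have /cvgrPdist_le := Fc i.1 i.2; apply.
have DF v i j x : differentiable F x ->
    ('D_v F x) i j = 'D_v (fun y => F y i j) x.
  by move=> Fd; rewrite derive_mx ?mxE//; exact: diff_derivable.
split=> [[Fd FC] i j|FC].
  split=> [x /Fd/differentiable_mxP//|v].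
  apply: eq_Ck_on ((IH _).1 (FC v) i j) => // x Ux.
  by rewrite DF//; exact: Fd.
have Fd x : U x -> differentiable F x.
  by move=> Ux; apply/differentiable_mxP => i j; case: (FC i j) => + _; apply.
split=> // v; apply/IH => i j.
apply: eq_Ck_on ((FC i j).2 v) => // x Ux.
by rewrite DF//; exact: Fd.
Unshelve. all: by end_near. Qed.

(** By the chain rule the derivative of the composite is taken along ['D_v phi x], which varies with
    [x]. Expanding this vector in the standard basis leaves products with derivatives of [f] in
    fixed directions, to which the induction applies. *)
Lemma Ck_on_comp V k n (U : set V) (U' : set 'rV[R]_n) (phi : V -> 'rV[R]_n)
    (f : 'rV[R]_n -> R) : open U -> (forall x, U x -> U' (phi x)) ->
  Ck_on k U phi -> Ck_on k U' f -> Ck_on k U (fun x => f (phi x)).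
Proof.
move=> oU UU'; elim: k f => [|k IH] f phiC fC.
  move=> x Ux; have := continuous_comp (phiC x Ux) (fC _ (UU' x Ux)).
  exact.
have [fd fC'] := Ck_onE fC; have [phid phiC'] := Ck_onE phiC.
split=> [x Ux|v].
  exact: (differentiable_comp (phid x Ux) (fd _ (UU' x Ux))).
apply: (@eq_Ck_on _ _ _ _ (fun x =>
    \sum_i ('D_v phi x) 0 i * 'D_(delta_mx 0 i) f (phi x))) => //.
  move=> x Ux; rewrite (@derive_val _ _ _ _ _ _ _
    (is_derive_chain v (phid x Ux) (fd _ (UU' x Ux)))).
  by rewrite derive_rowE//; exact: fd (UU' x Ux).
apply: Ck_on_sum => // i; apply: Ck_onM => //.
  exact: (Ck_on_mxP _ _ oU).1 (phiC' v) 0 i.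
exact: (IH _ (Ck_on_pred phiC) (fC' _)).
Qed.

End Ck.

(** * Symmetry of second derivatives *)

Section Schwarz.
Context {R : realType} {V : normedModType R}.

Lemma is_derive_line (W : normedModType R) (f : V -> W) (x u : V) (a : R) :
  differentiable f (x + a *: u) ->
  is_derive a 1 (fun b => f (x + b *: u)) ('D_u f (x + a *: u)).
Proof.
move=> df; pose phi (b : R) : V := x + b *: u.
have dphi : is_diff a phi (0 + *:%R^~ u) by exact: is_diffD.
have := is_derive_chain (1 : R) (@ex_diff _ _ _ _ _ _ _ dphi)
  (df : differentiable f (phi a)).
by rewrite (deriveE _ (@ex_diff _ _ _ _ _ _ _ dphi)) diff_val /= add0r scale1r.
Qed.

Lemma MVT_cc (F dF : R -> R) (s : R) : 0 < s ->
  (forall a, 0 <= a <= s -> is_derive a 1 F (dF a)) ->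
  exists2 a, 0 <= a <= s & F s - F 0 = dF a * s.
Proof.
move=> s0 HF; have [||a] := @MVT R F dF 0 s s0.
- by move=> a; rewrite in_itv/= => /andP[a0 As]; apply: HF; rewrite !ltW.
- by apply: derivable_within_continuous => a; rewrite in_itv/= => /HF[].
by rewrite in_itv/= subr0 => /andP[a0 As] E; exists a; rewrite // !ltW.
Qed.

Lemma MVT_line (f : V -> R) (x u : V) (s : R) : 0 < s ->
  (forall a, 0 <= a <= s -> differentiable f (x + a *: u)) ->
  exists2 a, 0 <= a <= s & f (x + s *: u) - f x = 'D_u f (x + a *: u) * s.
Proof.
move=> s0 df; have [a ha E] := MVT_cc s0 (fun a ha => is_derive_line (df a ha)).
by exists a => //; rewrite -E scale0r addr0.
Qed.

(** The mean value theorem is used twice: along [u] for the increment [F] of [f] by [s *: v], then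
    along [v] for ['D_u f]. *)
Lemma second_difference (f : V -> R) (x u v : V) (s : R) : 0 < s ->
  (forall a b, 0 <= a <= s -> 0 <= b <= s ->
    differentiable f (x + a *: u + b *: v) /\
    differentiable ('D_u f) (x + a *: u + b *: v)) ->
  exists a b, [/\ 0 <= a <= s, 0 <= b <= s &
    f (x + s *: u + s *: v) - f (x + s *: u) - (f (x + s *: v) - f x) =
    'D_v ('D_u f) (x + a *: u + b *: v) * s * s].
Proof.
move=> s0 df; have s0s : 0 <= s <= s by rewrite lexx ltW.
have z0s : 0 <= (0 : R) <= s by rewrite lexx ltW.
pose F y := f (y + s *: v) - f y.
have dF a : 0 <= a <= s -> is_derive a 1 (fun b => F (x + b *: u))
   ('D_u f (x + a *: u + s *: v) - 'D_u f (x + a *: u)).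
  move=> ha; apply: is_deriveB.
    have -> : (fun b => f (x + b *: u + s *: v)) =
      (fun b => f ((x + s *: v) + b *: u)).
      by apply/funext => b; rewrite addrAC.
    by rewrite addrAC; apply: is_derive_line; rewrite addrAC; case: (df a s ha).
  apply: is_derive_line.
  by case: (df a 0 ha z0s); rewrite scale0r addr0.
have [a ha] := MVT_cc s0 dF; rewrite /F scale0r addr0 => ->.
have [|b hb ->] := @MVT_line ('D_u f) (x + a *: u) v s s0; last by exists a, b.
by move=> b hb; case: (df a b ha hb).
Qed.

(** The second difference is symmetric in [u] and [v]. It therefore equates a value of one mixed
    derivative near [x] with a value of the other, and both are continuous at [x]. *)
Lemma derive_comm (U : set V) (f : V -> R) (x u v : V) : open U -> U x ->
  Ck_on 2 U f -> 'D_v ('D_u f) x = 'D_u ('D_v f) x.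
Proof.
move=> oU Ux /Ck_onE[fd f1].
apply/eqP; rewrite -subr_eq0 -normr_le0; apply/ler_addgt0Pl => e e0.
rewrite addr0.
have [fud fuc] := Ck_onE (f1 u); have [fvd fvc] := Ck_onE (f1 v).
have nU : nbhs x U by exact: open_nbhs_nbhs.
have e2 : 0 < e / 2 by rewrite divr_gt0.
have /cvgrPdist_le/(_ _ e2) nu := fuc v x Ux.
have /cvgrPdist_le/(_ _ e2) nv := fvc u x Ux.
have nn := filterI nU (filterI nu nv).
have [r /= r0 rP] := (nbhs_ballP _ _).1 (nn _ _).
(* Small enough for the whole parallelogram spanned by [s *: u] and [s *: v] to stay in the ball;
   the added 1 keeps the denominator positive when [u] and [v] vanish. *)
pose s := r / (`|u| + `|v| + 1).
have n1 : 0 < `|u| + `|v| + 1 by rewrite ltr_wpDl// addr_ge0.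
have s0 : 0 < s by rewrite divr_gt0.
(* Stated for [u'] and [v'] so as to serve both orders of [u] and [v]. *)
have sP a b u' v' : `|u'| + `|v'| = `|u| + `|v| -> 0 <= a <= s -> 0 <= b <= s ->
    ball x r (x + a *: u' + b *: v').
  move=> uv /andP[a0 As] /andP[b0 bs].
  rewrite -ball_normE /= -addrA opprD addNKr normrN.
  rewrite (le_lt_trans (ler_normD _ _))// !normrZ !ger0_norm//.
  apply: (@le_lt_trans _ _ (s * (`|u| + `|v|))).
    by rewrite -uv mulrDr lerD// ler_wpM2r.
  by rewrite /s mulrAC ltr_pdivrMr// ltr_pM2l// ltrDl.
have cancel (p q r' t w z : R) : p - q - (r' - t) = w * s * s ->
    p - r' - (q - t) = z * s * s -> w = z.
  move=> h1 h2; apply/(mulIf (lt0r_neq0 s0))/(mulIf (lt0r_neq0 s0)).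
  by rewrite -h1 -h2; ring.
have close (A B c d : R) : c = d -> `|A - c| <= e / 2 -> `|B - d| <= e / 2 ->
    `|A - B| <= e.
  move=> -> h1 h2; rewrite -(subrKA d) (le_trans (ler_normD _ _))//.
  by rewrite [leRHS]splitr lerD// distrC.
have [|a [b [ha hb E1]]] := @second_difference f x u v s s0.
  move=> a b ha hb; have [Uy _] := rP _ (sP _ _ u v erefl ha hb).
  by split; [exact: fd|exact: fud].
have [|a' [b' [ha' hb' E2]]] := @second_difference f x v u s s0.
  move=> a' b' ha' hb'; have [Uy _] := rP _ (sP _ _ v u (addrC _ _) ha' hb').
  by split; [exact: fd|exact: fvd].
have [_ [+ _]] := rP _ (sP _ _ u v erefl ha hb).
have [_ [_ +]] := rP _ (sP _ _ v u (addrC _ _) ha' hb').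
move=> /= D2 D1; have E : 'D_v ('D_u f) (x + a *: u + b *: v) =
    'D_u ('D_v f) (x + a' *: v + b' *: u).
  apply: cancel E1 _; rewrite -E2 (addrAC x (s *: v)).
  by [].
exact: close E D1 D2.
Qed.

End Schwarz.

Lemma derive_comm_mx (R : realType) (V : normedModType R) m n (U : set V)
    (F : V -> 'M[R]_(m, n)) x u v : open U -> U x -> Ck_on 2 U F ->
  'D_v ('D_u F) x = 'D_u ('D_v F) x.
Proof.
move=> oU Ux FC; have [Fd F1] := Ck_onE FC.
have E a b i j : ('D_b ('D_a F) x) i j = 'D_b ('D_a (fun y => F y i j)) x.
  have [Fad _] := Ck_onE (F1 a).
  rewrite derive_mx; last exact: diff_derivable (Fad x Ux).
  rewrite mxE; apply: near_eq_derive; apply: open_near Ux _ => // y Uy.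
  by rewrite derive_mx ?mxE//; exact: diff_derivable (Fd y Uy).
apply/matrixP => i j; apply: etrans (E u v i j) (etrans _ (esym (E v u i j))).
exact: derive_comm oU Ux ((Ck_on_mxP _ _ oU).1 FC i j).
Qed.

Lemma Ck_on_jacobian (R : realType) n m k (U : set 'rV[R]_n)
    (phi : 'rV[R]_n -> 'rV[R]_m) : open U -> Ck_on k.+1 U phi ->
  Ck_on k U (jacobian phi).
Proof.
move=> oU phiC; have [phid phi1] := Ck_onE phiC.
apply/Ck_on_mxP => // i j.
apply: eq_Ck_on ((Ck_on_mxP _ _ oU).1 (phi1 (delta_mx 0 i)) 0 j) => // x Ux.
by rewrite deriveE ?mxE//; exact: phid.
Qed.

(** * Connection, curvature and Lie derivative as matrices *)

Lemma e_E (R : realType) (i j : 'I_3) : e_ R i 0 j = (j == i)%:R.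
Proof. by rewrite /e_ mxE. Qed.

Section Connection.
Context {R : realType}.
Implicit Types (g : metric_field R) (p v : coords R).

(* The matrix of Z |-> nabla_v Z - 'D_v Z, acting on row vectors. *)
Definition conn_mx g p v : 'M[R]_3 :=
  \matrix_(j, k) \sum_i christoffel g k i j p * v 0 i.

Lemma nablaE g X Y p :
  nabla g X Y p = 'D_(X p) Y p + Y p *m conn_mx g p (X p).
Proof.
congr (_ + _); apply/rowP => k; rewrite !mxE exchange_big/=.
apply: eq_bigr => j _; rewrite mxE mulr_sumr; apply: eq_bigr => i _.
by rewrite mulrC.
Qed.

Lemma conn_mx_e g p i j k : conn_mx g p (e_ R i) j k = christoffel g k i j p.
Proof.
rewrite mxE (bigD1 i)//= big1 ?addr0 => [|l li]; rewrite e_E ?eqxx ?mulr1//.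
by rewrite (negPf li) mulr0.
Qed.

Lemma conn_mx_sum g p v :
  conn_mx g p v = \sum_i v 0 i *: conn_mx g p (e_ R i).
Proof.
apply/matrixP => j k; rewrite summxE mxE; apply: eq_bigr => i _.
by rewrite [in RHS]mxE conn_mx_e mulrC.
Qed.

(** Torsion-freeness, in matrix form. *)
Lemma conn_mx_sym g p u v : (forall q, (g q)^T = g q) ->
  u *m conn_mx g p v = v *m conn_mx g p u.
Proof.
move=> gT; apply/rowP => k; rewrite !mxE.
under eq_bigr do rewrite mxE mulr_sumr.
rewrite exchange_big/=; apply: eq_bigr => i _.
rewrite mxE mulr_sumr; apply: eq_bigr => j _.
by rewrite (christoffelC k i j)//; ring.
Qed.

(** Metric compatibility, in matrix form; both sides are linear in [v], so basis vectors suffice. *)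
Lemma derive_metric_mx g p v : (forall q, (g q)^T = g q) -> g p \in unitmx ->
  differentiable g p ->
  'D_v g p = conn_mx g p v *m g p + g p *m (conn_mx g p v)^T.
Proof.
move=> gT gU gd; rewrite derive_rowE// conn_mx_sum linear_sum mulmx_suml.
rewrite mulmx_sumr -big_split; apply: eq_bigr => k _ /=.
rewrite linearZ/= -scalemxAl -scalemxAr -scalerDr; congr (_ *: _).
apply/matrixP => i j; rewrite derive_mx ?mxE; last exact: diff_derivable.
rewrite (derive_metric k i j gT gU) big_split/=; congr (_ + _).
  by apply: eq_bigr => l _; rewrite conn_mx_e.
by apply: eq_bigr => l _; rewrite mxE conn_mx_e mulrC.
Qed.

(** Koszul's argument at a single point: the hypotheses on [N] are torsion-freeness and metric
    compatibility. Only values at [p] enter, because a pulled back metric is controlled on an open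
    set only. *)
Lemma conn_mx_unique g p (N : 'I_3 -> 'M[R]_3) :
  (g p)^T = g p -> g p \in unitmx -> differentiable g p ->
  (forall i j, row j (N i) = row i (N j)) ->
  (forall i, 'D_(e_ R i) g p = N i *m g p + g p *m (N i)^T) ->
  forall i, conn_mx g p (e_ R i) = N i.
Proof.
move=> gT gU gd NC Ng i; apply/matrixP => j k; rewrite conn_mx_e.
(* The symbols with lowered last index; they are symmetric in [a] and [b]. *)
pose L a b c := (N a *m g p) b c.
have LC a b c : L a b c = L b a c.
  have E d f : L d f c = (row f (N d) *m g p) 0 c by rewrite -row_mul mxE.
  by rewrite !E NC.
have DL a b c : 'D_(e_ R a) (fun q => g q b c) p = L a b c + L a c b.
  transitivity ('D_(e_ R a) g p b c).
    by rewrite derive_mx ?mxE//; exact: diff_derivable.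
  by rewrite Ng mxE -{2}gT -trmx_mul [in X in _ + X]mxE.
have -> : N i j k = (N i *m g p *m invmx (g p)) j k by rewrite mulmxK.
rewrite /christoffel mxE mulr_sumr; apply: eq_bigr => l _.
have -> : invmx (g p) l k = invmx (g p) k l.
  by rewrite -[in RHS]gT -trmx_inv [RHS]mxE.
(* Of the six terms in the Christoffel formula four cancel by symmetry, leaving twice [L i j l]. *)
rewrite !DL -/(L i j l) (LC j i l) (LC l i j) (LC l j i).
by move: (L _ _ _) (L _ _ _) (L _ _ _) (invmx _ _ _) => *; field.
Qed.

End Connection.

(** * Curvature and the soliton equation in the coordinate frame *)

Section Soliton.
Context {R : realType}.
Implicit Types (g : metric_field R) (p x : coords R) (X : vfield R).

Definition conn_e g i : coords R -> 'M[R]_3 := fun p => conn_mx g p (e_ R i).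

(* The matrix of R(d/dx^k, d/dx^i), acting on row vectors. *)
Definition curv_mx g k i p : 'M[R]_3 :=
  'D_(e_ R k) (conn_e g i) p - 'D_(e_ R i) (conn_e g k) p
  + conn_e g i p *m conn_e g k p - conn_e g k p *m conn_e g i p.

Definition ricci_mx g p : 'M[R]_3 :=
  \matrix_(i, j) \sum_k curv_mx g k i p j k.

Definition lie_mx g X p : 'M[R]_3 :=
  'D_(X p) g p + jacobian X p *m g p + g p *m (jacobian X p)^T.

Lemma e_mul n (A : 'M[R]_(3, n)) i : e_ R i *m A = row i A.
Proof. by rewrite rowE. Qed.

Lemma nabla_frame g i j p :
  nabla g (frame i) (frame j) p = row j (conn_e g i p).
Proof. by rewrite nablaE derive_cst add0r -e_mul. Qed.

(** Coordinate fields commute, so the bracket term vanishes. On row vectors the connection matrices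
    act from the right, hence the reversed order of the products in [curv_mx]. *)
Lemma curvature_frame g k i j p : (forall l, differentiable (conn_e g l) p) ->
  curvature g (frame k) (frame i) (frame j) p = row j (curv_mx g k i p).
Proof.
move=> gd; rewrite -e_mul /curvature.
have H a b : nabla g (frame a) (nabla g (frame b) (frame j)) p =
    e_ R j *m ('D_(e_ R a) (conn_e g b) p + conn_e g b p *m conn_e g a p).
  have -> : nabla g (frame b) (frame j) =
      fun q => cst (e_ R j) q *m conn_e g b q.
    by apply/funext => q; rewrite nabla_frame e_mul.
  have D := is_derive_mulmx (is_derive_cst (e_ R j) p (e_ R a))
    (is_derive_diff (e_ R a) (gd b)).
  rewrite nablaE (@derive_val _ _ _ _ _ _ _ D) mul0mx add0r.
  by rewrite mulmxDr mulmxA.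
have B : bracket (frame k) (frame i) p = 0 :> coords R.
  by rewrite /bracket !derive_cst subrr.
have G0 : conn_mx g p 0 = 0.
  by apply/matrixP => a b; rewrite !mxE big1// => c _; rewrite mxE mulr0.
rewrite !H [X in _ - X]nablaE B derive0 G0 mulmx0 addr0 subr0 -mulmxBr.
by congr (_ *m _); rewrite /curv_mx opprD addrACA addrA.
Qed.

Lemma ricciE g i j p : (forall l, differentiable (conn_e g l) p) ->
  ricci g (frame i) (frame j) p = ricci_mx g p i j.
Proof.
move=> gd; rewrite mxE; apply: eq_bigr => k _.
by rewrite mxE curvature_frame// mxE.
Qed.

(** The bracket of [X] with a frame field is minus a row of the Jacobian of [X], so the two bracket
    terms become the two Jacobian terms. *)
Lemma lieE g X i j p : differentiable g p -> differentiable X p ->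
  lie_metric g X (frame i) (frame j) p = lie_mx g X p i j.
Proof.
move=> gd Xd; rewrite /lie_metric.
have mul_e (w : coords R) b : (w *m (e_ R b)^T) 0 0 = w 0 b.
  rewrite mxE (bigD1 b)//= big1 ?addr0 => [|l lb]; rewrite mxE e_E.
    by rewrite eqxx mulr1.
  by rewrite (negPf lb) mulr0.
have P a b : pairing g (frame a) (frame b) = fun q => g q a b.
  by apply/funext => q; rewrite /pairing mul_e e_mul mxE.
have B a : bracket X (frame a) p = - row a (jacobian X p).
  by rewrite /bracket derive_cst sub0r deriveEjacobian// e_mul.
rewrite P /pairing !B mulNmx mulNmx -row_mul linearN/= mulmxN e_mul.
rewrite [X in _ - X - _]mxE mul_e [X in _ - _ - X]mxE !opprK.
rewrite [RHS]mxE [in RHS]mxE; congr (_ + _ + _).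
- by rewrite derive_mx ?mxE//; exact: diff_derivable.
- by rewrite mxE.
- by rewrite !mxE; apply: eq_bigr => l _; rewrite !mxE.
Qed.

(** Matrix form of the equation, suited to congruence by a Jacobian. *)
Lemma soliton_eqP g X lambda p : differentiable g p -> differentiable X p ->
  (forall l, differentiable (conn_e g l) p) ->
  soliton_eq g X lambda p <-> lie_mx g X p + ricci_mx g p = lambda *: g p.
Proof.
move=> gd Xd cd; split=> [S|S i j].
  apply/matrixP => i j; have := S i j.
  by rewrite lieE// ricciE// => {}S; rewrite mxE S mxE.
by rewrite lieE// ricciE//; have /matrixP/(_ i j) := S; rewrite !mxE.
Qed.

End Soliton.

(** * Invariance of the soliton equation under changes of coordinates *)

Section MatrixCalculus.
Context {R : realType} {V : normedModType R}.

Lemma differentiable_mulmx m n p (F : V -> 'M[R]_(m, n)) (G : V -> 'M[R]_(n, p))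
    x : differentiable F x -> differentiable G x ->
  differentiable (fun y => F y *m G y) x.
Proof.
move=> /differentiable_mxP HF /differentiable_mxP HG; apply/differentiable_mxP.
move=> i j.
have -> : (fun y => (F y *m G y) i j) =
          \sum_k (fun y => F y i k) * (fun y => G y k j).
  by apply/funext => y; rewrite mxE fct_sumE.
by apply: differentiable_sum => k; apply: differentiableM.
Qed.

Lemma differentiable_trmx m n (F : V -> 'M[R]_(m, n)) x :
  differentiable F x -> differentiable (fun y => (F y)^T) x.
Proof.
move=> /differentiable_mxP HF; apply/differentiable_mxP => i j.
by have -> : (fun y => (F y)^T i j) = (fun y => F y j i)
  by apply/funext => y; rewrite mxE.
Qed.

Lemma differentiable_scalemx m n (a : V -> R) (F : V -> 'M[R]_(m, n)) x :
  differentiable a x -> differentiable F x ->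
  differentiable (fun y => a y *: F y) x.
Proof.
move=> ad /differentiable_mxP HF; apply/differentiable_mxP => i j.
have -> : (fun y => (a y *: F y) i j) = a * (fun y => F y i j).
  by apply/funext => y; rewrite mxE.
exact: differentiableM.
Qed.

Lemma derive_scalemx m n (a : V -> R) (F : V -> 'M[R]_(m, n)) x v :
  differentiable a x -> differentiable F x ->
  'D_v (fun y => a y *: F y) x = 'D_v a x *: F x + a x *: 'D_v F x.
Proof.
move=> ad Fd; apply: derive_val.
apply/is_derive_mxP => i j; rewrite !mxE.
have -> : (fun y => (a y *: F y) i j) = a * (fun y => F y i j).
  by apply/funext => y; rewrite mxE.
have /is_derive_mxP/(_ i j) HF := is_derive_diff v Fd.
have := is_deriveM (is_derive_diff v ad) HF.
by rewrite addrC/= [_ *: 'D_v a x]mulrC.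
Qed.

Lemma derive_mulmx m n p (F : V -> 'M[R]_(m, n)) (G : V -> 'M[R]_(n, p)) x v :
  differentiable F x -> differentiable G x ->
  'D_v (fun y => F y *m G y) x = 'D_v F x *m G x + F x *m 'D_v G x.
Proof.
move=> Fd Gd; apply: derive_val.
by apply: is_derive_mulmx; exact: is_derive_diff.
Qed.

Lemma derive_trmx m n (F : V -> 'M[R]_(m, n)) x v :
  differentiable F x -> 'D_v (fun y => (F y)^T) x = ('D_v F x)^T.
Proof.
by move=> Fd; apply: derive_val; apply: is_derive_trmx; exact: is_derive_diff.
Qed.

Lemma derive_chain (U W : normedModType R) (phi : V -> U) (f : U -> W) x v :
  differentiable phi x -> differentiable f (phi x) ->
  'D_v (fun y => f (phi y)) x = 'D_('D_v phi x) f (phi x).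
Proof. by move=> dp df; apply: derive_val; exact: is_derive_chain. Qed.

Lemma derive_fun_sum n (W : normedModType R) (f : 'I_n -> V -> W) x v :
  (forall i, differentiable (f i) x) ->
  'D_v (fun y => \sum_i f i y) x = \sum_i 'D_v (f i) x.
Proof.
move=> fd; have -> : (fun y => \sum_i f i y) = \sum_i f i.
  by apply/funext => y; rewrite fct_sumE.
by apply: derive_sum => i; exact: diff_derivable.
Qed.

Lemma differentiable_fun_sum n (W : normedModType R) (f : 'I_n -> V -> W) x :
  (forall i, differentiable (f i) x) ->
  differentiable (fun y => \sum_i f i y) x.
Proof.
move=> fd; have -> : (fun y => \sum_i f i y) = \sum_i f i.
  by apply/funext => y; rewrite fct_sumE.
exact: differentiable_sum.
Qed.

End MatrixCalculus.

(** The algebra behind the Lie derivative of a pulled back metric: [M] and [N] stand for the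
    Jacobians of the two fields, and the [DJ] terms of [N *m H] and its transpose cancel those of
    [DH]. *)
Lemma lie_mx_alg (R : realType) n (G Dg H DH J DJ M N : 'M[R]_n) :
  G^T = G -> H = J *m G *m J^T -> N *m J = J *m M - DJ ->
  DH = DJ *m G *m J^T + J *m Dg *m J^T + J *m G *m DJ^T ->
  DH + N *m H + H *m N^T = J *m (Dg + M *m G + G *m M^T) *m J^T.
Proof.
move=> GT HE NJ ->.
have HT : H^T = H by rewrite HE !trmx_mul trmxK GT mulmxA.
have -> : H *m N^T = (N *m H)^T by rewrite [RHS]trmx_mul HT.
have NH : N *m H = J *m M *m G *m J^T - DJ *m G *m J^T.
  by rewrite HE !mulmxA NJ !mulmxBl.
have -> : (N *m H)^T = J *m G *m M^T *m J^T - J *m G *m DJ^T.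
  by rewrite NH linearB/= !trmx_mul !trmxK GT !mulmxA.
rewrite NH !(mulmxDr, mulmxDl) !mulmxA; move: (J *m G *m DJ^T) => a.
move: (DJ *m _ *m _) (J *m Dg *m _) (J *m M *m _ *m _) => b c d.
move: (J *m _ *m _ *m _) => e.
by apply/matrixP => i j; rewrite !mxE; ring.
Qed.

(* Throughout, [h] is the pullback of [g] along [phi] on [U], the row [i] of the
   Jacobian [J] is the tangent vector [D_i phi], and [K] is the inverse of [J];
   in the basis of the rows of [J], the Levi-Civita connection of [h] has the
   matrices [A v x] of the pulled back connection, up to the gauge change
   [K]. *)
Section Pullback.
Context {R : realType} (U : set 'rV[R]_3) (phi : coords R -> coords R).
Context (K : coords R -> 'M[R]_3) (g h : metric_field R).
Context (oU : open U) (phiC : Ck_on 3 U phi).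
Context (Kd : forall x, U x -> differentiable K x).
Context (JK : forall x, U x -> 'J phi x *m K x = 1%:M).
Context (gT : forall y, (g y)^T = g y) (gU : forall y, g y \in unitmx).
Context (gd : forall y, differentiable g y).
Context (cd : forall i y, differentiable (conn_e g i) y).
Context (hE : forall x, U x ->
  h x = 'J phi x *m g (phi x) *m ('J phi x)^T).

Let J := jacobian phi.
Let A (v x : coords R) : 'M[R]_3 := conn_mx g (phi x) (v *m J x).

Let phid x : U x -> differentiable phi x.
Proof. by have [+ _] := Ck_onE phiC; apply. Qed.

Let JC : Ck_on 2 U J.
Proof. exact: Ck_on_jacobian. Qed.

Let Jd x : U x -> differentiable J x.
Proof. by have [+ _] := Ck_onE JC; apply. Qed.

Let KJ x : U x -> K x *m J x = 1%:M.
Proof. by move=> Ux; apply: mulmx1C; exact: JK. Qed.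

(** Both sides are second derivatives of [phi], which commute. *)
Lemma derive_jacobianC u v x : U x -> u *m 'D_v J x = v *m 'D_u J x.
Proof.
have H a b y : U y -> a *m 'D_b J y = 'D_b ('D_a phi) y.
  move=> Uy; have -> : 'D_b ('D_a phi) y = 'D_b (fun z => cst a z *m J z) y.
    apply: near_eq_derive; apply: open_near Uy _ => // z Uz.
    by rewrite deriveEjacobian//; exact: phid.
  by rewrite derive_mulmx ?derive_cst ?mul0mx ?add0r//; exact: Jd.
move=> Ux; rewrite (H u v x Ux) (H v u x Ux).
exact: derive_comm_mx oU Ux (Ck_on_pred phiC).
Qed.

Let gphid x : U x -> differentiable (fun y => g (phi y)) x.
Proof. by move=> Ux; apply: (differentiable_comp (phid Ux)). Qed.

Let Dgphi v x : U x ->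
  'D_v (fun y => g (phi y)) x = 'D_(v *m J x) g (phi x).
Proof.
move=> Ux; rewrite (derive_chain v (phid Ux) (gd _)) deriveEjacobian//.
exact: phid.
Qed.

Let hd x : U x -> differentiable h x.
Proof.
move=> Ux; apply: (@near_eq_differentiable _ _ _
    (fun y => J y *m g (phi y) *m (J y)^T)).
  by apply: open_near Ux _ => // y Uy; rewrite hE.
apply: differentiable_mulmx; last exact: differentiable_trmx (Jd Ux).
by apply: differentiable_mulmx; [exact: Jd|exact: gphid].
Qed.

Let Dh v x : U x -> 'D_v h x =
  'D_v J x *m g (phi x) *m (J x)^T + J x *m 'D_(v *m J x) g (phi x) *m (J x)^T
  + J x *m g (phi x) *m ('D_v J x)^T.
Proof.
move=> Ux; transitivity ('D_v (fun y => J y *m g (phi y) *m (J y)^T) x).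
  by apply: near_eq_derive; apply: open_near Ux _ => // y Uy; rewrite hE.
have JJ := Jd Ux; have gg := gphid Ux.
rewrite derive_mulmx; [|exact: differentiable_mulmx|exact: differentiable_trmx].
by rewrite derive_mulmx// derive_trmx// mulmxDl Dgphi.
Qed.

Let hT x : U x -> (h x)^T = h x.
Proof. by move=> Ux; rewrite hE// !trmx_mul trmxK gT mulmxA. Qed.

Let hU x : U x -> h x \in unitmx.
Proof.
move=> Ux; have [JU _] := mulmx1_unit (JK Ux).
by rewrite hE// !unitmx_mul unitmx_tr JU gU.
Qed.

Let AE v x : A v x = \sum_b (v *m J x) 0 b *: conn_e g b (phi x).
Proof. exact: conn_mx_sum. Qed.

Let cphid b x : U x -> differentiable (fun y => conn_e g b (phi y)) x.
Proof. by move=> Ux; apply: (differentiable_comp (phid Ux)). Qed.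

Let vJd (v : coords R) b x : U x -> differentiable (fun y => (v *m J y) 0 b) x.
Proof.
move=> Ux; have vJ : differentiable (fun y => cst v y *m J y) x.
  by apply: differentiable_mulmx => //; exact: Jd.
by have /differentiable_mxP := vJ; apply.
Qed.

Let Ad v x : U x -> differentiable (A v) x.
Proof.
move=> Ux; have -> : A v = fun y => \sum_b (v *m J y) 0 b *: conn_e g b (phi y).
  by apply/funext => y; rewrite AE.
apply: differentiable_fun_sum => b; apply: differentiable_scalemx.
  exact: vJd.
exact: cphid.
Qed.

(** The first term comes from the moving direction [v *m J x]; it is symmetric in [u] and [v] and so
    drops out of the curvature. The double sum is tensorial. *)
Let DA u v x : U x -> 'D_u (A v) x = conn_mx g (phi x) (v *m 'D_u J x)
  + \sum_a \sum_b ((u *m J x) 0 a * (v *m J x) 0 b)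
      *: 'D_(e_ R a) (conn_e g b) (phi x).
Proof.
move=> Ux; have -> : A v = fun y => \sum_b (v *m J y) 0 b *: conn_e g b (phi y).
  by apply/funext => y; rewrite AE.
have vJ b := @vJd v b x Ux; have cph b := @cphid b x Ux.
rewrite derive_fun_sum; last by move=> b; exact: differentiable_scalemx.
rewrite conn_mx_sum exchange_big -big_split/=; apply: eq_bigr => b _.
rewrite derive_scalemx//; congr (_ *: _ + _).
  transitivity ('D_u (fun y => cst v y *m J y) x 0 b).
    rewrite derive_mx ?mxE//; apply: diff_derivable.
    by apply: differentiable_mulmx => //; exact: Jd.
  by rewrite derive_mulmx// ?derive_cst ?mul0mx ?add0r//; exact: Jd.
rewrite (derive_chain u (phid Ux) (cd _ _)) deriveEjacobian; last exact: phid.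
rewrite derive_rowE// scaler_sumr; apply: eq_bigr => a _.
by rewrite scalerA mulrC.
Qed.

Lemma conn_pullback i x : U x ->
  conn_e h i x = ('D_(e_ R i) J x + J x *m A (e_ R i) x) *m K x.
Proof.
move=> Ux; pose N i := ('D_(e_ R i) J x + J x *m A (e_ R i) x) *m K x.
apply: (@conn_mx_unique _ _ _ N); [exact: hT|exact: hU|exact: hd| |].
  (* Torsion-freeness: the derivative of [J] is symmetric by [derive_jacobianC], the remaining part
     by that of [g]. *)
  move=> a b; rewrite /N -!e_mul !mulmxA !mulmxDr (derive_jacobianC _ _ Ux).
  by congr ((_ + _) *m _); rewrite !mulmxA /A; exact: conn_mx_sym.
move=> a; have -> : h x *m (N a)^T = (N a *m h x)^T by rewrite [RHS]trmx_mul hT.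
have -> : N a *m h x = ('D_(e_ R a) J x + J x *m A (e_ R a) x) *m g (phi x)
    *m (J x)^T.
  by rewrite hE// /N !mulmxA -(mulmxA _ (K x)) KJ// mulmx1.
rewrite Dh// (derive_metric_mx _ gT)// -/(A (e_ R a) x).
rewrite !(mulmxDl, mulmxDr) linearD/= !trmx_mul !trmxK !gT !mulmxA.
rewrite -!addrA; congr (_ + (_ + _)); exact: addrC.
Qed.

Let conn_hJ i x : U x ->
  conn_e h i x *m J x = 'D_(e_ R i) J x + J x *m A (e_ R i) x.
Proof. by move=> Ux; rewrite conn_pullback// -mulmxA KJ// mulmx1. Qed.

Let DJd v x : U x -> differentiable ('D_v J) x.
Proof.
by move=> Ux; have [_ /(_ v)/Ck_onE[+ _]] := Ck_onE JC; apply.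
Qed.

Let JAd v x : U x -> differentiable (fun y => J y *m A v y) x.
Proof. by move=> Ux; apply: differentiable_mulmx; [exact: Jd|exact: Ad]. Qed.

Let conn_hd i x : U x -> differentiable (conn_e h i) x.
Proof.
move=> Ux; apply: (@near_eq_differentiable _ _ _
    (fun y => ('D_(e_ R i) J y + J y *m A (e_ R i) y) *m K y)).
  by apply: open_near Ux _ => // y Uy; rewrite conn_pullback.
apply: differentiable_mulmx; last exact: Kd.
by apply: differentiableD; [exact: DJd|exact: JAd].
Qed.

(** Under the gauge change the curvature of [h] is conjugated to that of [A], which is bilinear in
    the rows [k] and [i] of [J x]. *)
Lemma curv_pullback k i x : U x -> curv_mx h k i x =
  J x *m (\sum_a \sum_b (J x k a * J x i b) *: curv_mx g a b (phi x)) *m K x.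
Proof.
move=> Ux.
(* [D_k (Gamma_i J)], rewritten by [conn_hJ], is symmetric in [i], [k] up to
   [J *m (D_k A_i + A_i A_k)]. *)
have E a b : 'D_(e_ R a) (conn_e h b) x *m J x
    + conn_e h b x *m conn_e h a x *m J x =
  ('D_(e_ R a) ('D_(e_ R b) J) x
    + ('D_(e_ R a) J x *m A (e_ R b) x + 'D_(e_ R b) J x *m A (e_ R a) x))
  + J x *m ('D_(e_ R a) (A (e_ R b)) x + A (e_ R b) x *m A (e_ R a) x).
  have D : 'D_(e_ R a) (fun y => conn_e h b y *m J y) x =
      'D_(e_ R a) (fun y => 'D_(e_ R b) J y + J y *m A (e_ R b) y) x.
    by apply: near_eq_derive; apply: open_near Ux _ => // y Uy; rewrite conn_hJ.
  have JJ := Jd Ux; have chd := conn_hd b Ux; have AA := Ad (e_ R b) Ux.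
  rewrite (derive_mulmx _ chd JJ) in D.
  rewrite deriveD in D; [|exact: diff_derivable (DJd _ Ux)
                         |exact: diff_derivable (JAd _ Ux)].
  rewrite (derive_mulmx _ JJ AA) in D.
  rewrite -[X in _ + X]mulmxA conn_hJ// (mulmxDr (conn_e h b x)).
  rewrite (mulmxA (conn_e h b x)) conn_hJ// (mulmxDl _ _ (A (e_ R a) x)).
  rewrite addrA D (mulmxDr (J x)) (mulmxA (J x) (A (e_ R b) x)).
  by rewrite -[LHS]addrA -[RHS]addrA; congr (_ + _); exact: addrACA.
have F : curv_mx h k i x *m J x = J x *m (
    ('D_(e_ R k) (A (e_ R i)) x + A (e_ R i) x *m A (e_ R k) x)
    - ('D_(e_ R i) (A (e_ R k)) x + A (e_ R k) x *m A (e_ R i) x)).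
  have -> : curv_mx h k i x *m J x =
    ('D_(e_ R k) (conn_e h i) x *m J x + conn_e h i x *m conn_e h k x *m J x)
    - ('D_(e_ R i) (conn_e h k) x *m J x + conn_e h k x *m conn_e h i x *m J x).
    by rewrite /curv_mx !(mulmxDl, mulNmx) opprD addrACA addrA.
  have cancel (S S' p q r r' : 'M[R]_3) : S = S' ->
      S + (p + q) + r - (S' + (q + p) + r') = r - r'.
    by move=> ->; rewrite (addrC p) [X in X - _]addrC addrKA.
  apply: etrans (congr2 (fun u w => u - w) (E k i) (E i k)) _.
  apply: etrans (cancel _ _ _ _ _ _ _) _; last exact: esym (mulmxBr _ _ _).
  (* Second derivatives of [J] commute; this is where [phi] of class C^3 is used. *)
  exact: derive_comm_mx oU Ux JC.
rewrite -[LHS]mulmx1 -(JK Ux) mulmxA F; congr (_ *m _ *m _).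
have eJ a b : (e_ R a *m J x) 0 b = J x a b by rewrite e_mul mxE.
pose dsum (f : 'I_3 -> 'I_3 -> 'M[R]_3) :=
  \sum_a \sum_b (J x k a * J x i b) *: f a b.
have dsumC (f : 'I_3 -> 'I_3 -> 'M[R]_3) :
    \sum_a \sum_b (J x i a * J x k b) *: f a b = dsum (fun a b => f b a).
  rewrite exchange_big; apply: eq_bigr => a _; apply: eq_bigr => b _.
  by rewrite mulrC.
have AA a b : A (e_ R b) x *m A (e_ R a) x = \sum_c \sum_d
    (J x a c * J x b d) *: (conn_e g d (phi x) *m conn_e g c (phi x)).
  rewrite !AE mulmx_sumr; apply: eq_bigr => c _; rewrite mulmx_suml.
  apply: eq_bigr => d _.
  by rewrite -scalemxAl -scalemxAr scalerA !eJ mulrC.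
have DE a b : 'D_(e_ R a) (A (e_ R b)) x =
    conn_mx g (phi x) (e_ R b *m 'D_(e_ R a) J x) + \sum_c \sum_d
    (J x a c * J x b d) *: 'D_(e_ R c) (conn_e g d) (phi x).
  rewrite (DA _ _ Ux); congr (_ + _).
  by apply: eq_bigr => c _; apply: eq_bigr => d _; rewrite !eJ.
have cancel (c c' s1 s2 m1 m2 : 'M[R]_3) : c = c' ->
    c + s1 + m1 - (c' + s2 + m2) = s1 - s2 + m1 - m2.
  move=> ->; rewrite -(addrA c' s1) -(addrA c' s2) [X in X - _]addrC addrKA.
  by rewrite opprD addrACA addrA.
rewrite (DE k i) (DE i k) (AA k i) (AA i k) !dsumC.
(* The non-tensorial terms of the two derivatives of [A] coincide, so they disappear from the
   difference. *)
rewrite cancel; last by rewrite (derive_jacobianC (e_ R i) (e_ R k) Ux).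
rewrite /dsum -sumrB -big_split -sumrB/=; apply: eq_bigr => a _.
rewrite -sumrB -big_split -sumrB/=; apply: eq_bigr => b _.
by rewrite -scalerBr -scalerDr -scalerBr.
Qed.

(** Taking the trace over [k] multiplies [K x] by [J x] on the right, and their product is the
    identity; the trace thus becomes the one for [g]. *)
Lemma ricci_pullback x : U x ->
  ricci_mx h x = J x *m ricci_mx g (phi x) *m (J x)^T.
Proof.
move=> Ux; apply/matrixP => i j.
pose F a b := curv_mx g a b (phi x).
have Ric b c : ricci_mx g (phi x) b c = \sum_a F a b c a by rewrite mxE.
transitivity (\sum_a \sum_b J x i b * \sum_c F a b c a * J x j c); last first.
  rewrite -mulmxA [RHS]mxE exchange_big; apply: eq_bigr => b _ /=.
  rewrite -mulr_sumr exchange_big [X in _ = _ * X]mxE; congr (_ * _).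
  apply: eq_bigr => c _ /=; rewrite Ric [X in _ = _ * X]mxE mulr_suml.
  by [].
transitivity (\sum_a \sum_b J x i b * (J x *m F a b *m K x *m J x) j a);
  last first.
  apply: eq_bigr => a _; apply: eq_bigr => b _; congr (_ * _).
  rewrite -mulmxA KJ// mulmx1 mxE; apply: eq_bigr => c _; exact: mulrC.
rewrite mxE; under eq_bigr => k _.
  rewrite curv_pullback// mulmx_sumr mulmx_suml summxE; over.
rewrite exchange_big; apply: eq_bigr => a _ /=.
under eq_bigr => k _ do rewrite mulmx_sumr mulmx_suml summxE.
rewrite exchange_big; apply: eq_bigr => b _ /=.
rewrite [X in _ * X]mxE mulr_sumr; apply: eq_bigr => k _.
by rewrite -scalemxAr -scalemxAl mxE -/(F a b); ring.
Qed.

Context (X X' : vfield R).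
Context (Xd : forall y, differentiable X y).
Context (XE : forall x, U x -> X' x = X (phi x) *m K x).

Let XJ x : U x -> X' x *m J x = X (phi x).
Proof. by move=> Ux; rewrite XE// -mulmxA KJ// mulmx1. Qed.

Let Xphid x : U x -> differentiable (fun y => X (phi y)) x.
Proof. by move=> Ux; apply: (differentiable_comp (phid Ux)). Qed.

Let X'd x : U x -> differentiable X' x.
Proof.
move=> Ux; apply: (@near_eq_differentiable _ _ _ (fun y => X (phi y) *m K y)).
  by apply: (open_near oU Ux) => y Uy; exact: esym (XE Uy).
by apply: differentiable_mulmx; [exact: Xphid|exact: Kd].
Qed.

Lemma lie_pullback x : U x ->
  lie_mx h X' x = J x *m lie_mx g X (phi x) *m (J x)^T.
Proof.
move=> Ux.
(* Differentiate [X' y *m J y = X (phi y)] and move the derivative of [J] to the direction [X' x] by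
   [derive_jacobianC]. *)
have E : jacobian X' x *m J x =
    J x *m jacobian X (phi x) - 'D_(X' x) J x.
  apply/row_matrixP => i; rewrite -!e_mul mulmxBr.
  apply: etrans _ (congr1 (fun w => e_ R i *m (J x *m jacobian X (phi x)) - w)
    (derive_jacobianC (X' x) (e_ R i) Ux)).
  have D : e_ R i *m jacobian X' x *m J x + X' x *m 'D_(e_ R i) J x =
      e_ R i *m J x *m jacobian X (phi x).
    transitivity ('D_(e_ R i) (fun y => X' y *m J y) x).
      rewrite (derive_mulmx _ (X'd Ux) (Jd Ux)); congr (_ *m _ + _).
      exact: esym (deriveEjacobian _ (X'd Ux)).
    transitivity ('D_(e_ R i) (fun y => X (phi y)) x).
      by apply: near_eq_derive; apply: open_near Ux _ => // y Uy; rewrite XJ.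
    rewrite (derive_chain _ (phid Ux) (Xd _)) (deriveEjacobian _ (phid Ux)).
    exact: deriveEjacobian.
  have subr_l (e w : coords R) (P Q S T : 'M[R]_3) :
      e *m P *m Q + w = e *m S *m T -> e *m (P *m Q) = e *m (S *m T) - w.
    by move=> E; rewrite !mulmxA -E addrK.
  exact: subr_l D.
have DhE := Dh (X' x) Ux; rewrite (XJ Ux) in DhE.
exact: lie_mx_alg (gT _) (hE Ux) E DhE.
Qed.

(** All terms of the matrix equation undergo the same congruence by [J x], so [lambda] is
    unchanged. *)
Lemma soliton_eq_pullback lambda x : U x ->
  soliton_eq g X lambda (phi x) -> soliton_eq h X' lambda x.
Proof.
move=> Ux /(soliton_eqP _ (gd _) (Xd _) (cd ^~ _)) S.
apply/(soliton_eqP _ (hd Ux) (X'd Ux) (fun i => conn_hd i Ux)).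
rewrite lie_pullback// ricci_pullback// -mulmxDl -mulmxDr S hE//.
by rewrite -scalemxAr -scalemxAl.
Qed.

End Pullback.

(** * The metric [gs_metric] *)

Lemma forall_ord3 (P : 'I_3 -> Prop) :
  P 0 -> P 1 -> P 2%:R -> forall i, P i.
Proof.
by move=> P0 P1 P2 [[|[|[|//]]] h]; [move: P0|move: P1|move: P2];
   congr P; exact/val_inj.
Qed.

Lemma sum_ord3 (V : nmodType) (f : 'I_3 -> V) :
  \sum_i f i = f 0 + f 1 + f 2%:R.
Proof.
rewrite !big_ord_recl big_ord0 addr0 addrA.
by congr (_ + _ + _); congr f; exact/val_inj.
Qed.

(** * Affine maps, covering the soliton field, translations and the identity *)

Section AffineMaps.
Context {R : realType} {n m : nat}.

Lemma differentiable_affine (a : 'rV[R]_m) (M : 'M[R]_(n, m)) p :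
  differentiable (fun q => a + q *m M) p.
Proof.
by apply: differentiableD => //; exact: (@differentiable_mulmx _ _ _ _ _ id).
Qed.

Lemma derive_affine (a : 'rV[R]_m) (M : 'M[R]_(n, m)) p v :
  'D_v (fun q => a + q *m M) p = v *m M.
Proof.
rewrite deriveD => [|//|]; last first.
  by apply: diff_derivable; exact: (@differentiable_mulmx _ _ _ _ _ id).
rewrite derive_cst add0r (@derive_mulmx _ _ _ _ _ id (cst M))//.
by rewrite derive_cst mulmx0 addr0 derive_id.
Qed.

Lemma jacobian_affine (a : 'rV[R]_m) (M : 'M[R]_(n, m)) p :
  jacobian (fun q => a + q *m M) p = M.
Proof.
apply/row_matrixP => i; rewrite !rowE -(derive_affine a M p).
exact: esym (deriveEjacobian _ (differentiable_affine a M p)).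
Qed.

Lemma smooth_affine (a : 'rV[R]_m) (M : 'M[R]_(n, m)) U :
  smooth_on U (fun q => a + q *m M).
Proof.
(* Aiming at class [k.+1] avoids a separate case [k = 0]: the derivatives are constant. *)
move=> k; apply: Ck_on_pred; split=> [p _|v].
  exact: differentiable_affine.
have -> : 'D_v (fun q => a + q *m M) = cst (v *m M).
  by apply/funext => p; rewrite derive_affine.
exact: Ck_on_cst.
Qed.

End AffineMaps.

(** * Matrices whose entries depend on [t] alone *)

Section ThirdCoordinate.
Context {R : realType} {m n : nat} (f df : nat -> nat -> R -> R).
Context (fE : forall i j (t : R), is_derive t 1 (f i j) (df i j t)).

(** Entries are indexed by [nat] so that they can be defined by [match] and compute once
    [forall_ord3] has fixed the indices. *)
Definition mx_of_t (h : nat -> nat -> R -> R) (p : coords R) : 'M[R]_(m, n) :=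
  \matrix_(i, j) h i j (p 0 2).

Let entryE i j :
  (fun p => mx_of_t f p i j) = f i j \o (fun p : coords R => p 0 2).
Proof. by apply/funext => p; rewrite mxE. Qed.

Let fd i j t : differentiable (f i j) t.
Proof. by apply/derivable1_diffP; case: (fE i j t). Qed.

Lemma differentiable_mx_of_t p : differentiable (mx_of_t f) p.
Proof.
apply/differentiable_mxP => i j; rewrite entryE.
apply: differentiable_comp => //; exact: differentiable_coord.
Qed.

Lemma derive_mx_of_t p v : 'D_v (mx_of_t f) p = v 0 2 *: mx_of_t df p.
Proof.
rewrite derive_mx; last exact: diff_derivable (differentiable_mx_of_t p).
apply/matrixP => i j; rewrite !mxE entryE.
have cd : differentiable (fun p : coords R => p 0 2) p.
  exact: differentiable_coord.
rewrite (derive_chain v cd (fd i j _)).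
have -> : 'D_v (fun p : coords R => p 0 2) p = v 0 2.
  by apply: derive_val; have /is_derive_mxP := is_derive_id p v; apply.
rewrite deriveE// -[v 0 2]mulr1 -[v 0 2 * 1]/(v 0 2 *: 1) linearZ/=.
congr (_ * _); first exact: esym (mulr1 _).
rewrite -(deriveE (1 : R) (fd i j _)); exact: derive_val.
Qed.

End ThirdCoordinate.

Section GsMetric.
Context {R : realType} (eps mu : R) (eps0 : eps != 0) (mu0 : mu != 0).

Definition gs_comp (i j : nat) (t : R) : R :=
  match i, j with
  | 0, 0 => eps * expR (2 * t)
  | 1, 1 => eps * expR (- (2 * t))
  | 2, 2 => mu
  | _, _ => 0
  end.

Definition dgs_comp (i j : nat) (t : R) : R :=
  match i, j with
  | 0, 0 => 2 * (eps * expR (2 * t))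
  | 1, 1 => - 2 * (eps * expR (- (2 * t)))
  | _, _ => 0
  end.

(* [gs_gamma i j k] is Gamma^k_ij. *)
Definition gs_gamma (i j k : nat) (t : R) : R :=
  match i, j, k with
  | 0, 0, 2 => - (eps * expR (2 * t)) / mu
  | 0, 2, 0 | 2, 0, 0 => 1
  | 1, 1, 2 => eps * expR (- (2 * t)) / mu
  | 1, 2, 1 | 2, 1, 1 => - 1
  | _, _, _ => 0
  end.

(** Both cases have the factor -2: its sign comes from the symbol for [i = 0] and from the exponent
    for [i = 1]. *)
Definition dgs_gamma (i j k : nat) (t : R) : R :=
  match i, j, k with
  | 0, 0, 2 | 1, 1, 2 =>
      - 2 * (eps * expR (if i is 0 then 2 * t else - (2 * t))) / mu
  | _, _, _ => 0
  end.

Lemma gs_metricE : gs_metric eps mu = mx_of_t gs_comp.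
Proof.
apply/funext => p; apply/matrixP => i j; rewrite !mxE.
by move: i j; do 2!elim/forall_ord3.
Qed.

Let dE (t : R) :
  is_derive t 1 (fun t => eps * expR (2 * t)) (2 * (eps * expR (2 * t))).
Proof. by apply: is_derive_eq; rewrite /GRing.scale/=; ring. Qed.

Let dF (t : R) : is_derive t 1 (fun t => eps * expR (- (2 * t)))
  (- 2 * (eps * expR (- (2 * t)))).
Proof. by apply: is_derive_eq; rewrite /GRing.scale/=; ring. Qed.

Lemma is_derive_gs_comp i j (t : R) :
  is_derive t 1 (gs_comp i j) (dgs_comp i j t).
Proof.
by case: i => [|[|[|i]]]; case: j => [|[|[|j]]];
   first [exact: dE|exact: dF|exact: is_derive_cst].
Qed.

Lemma is_derive_gs_gamma i j k (t : R) :
  is_derive t 1 (gs_gamma i j k) (dgs_gamma i j k t).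
Proof.
have dE' : is_derive t 1 (fun t => - (eps * expR (2 * t)) / mu)
    (- 2 * (eps * expR (2 * t)) / mu).
  by apply: is_derive_eq; rewrite /GRing.scale/=; ring.
have dF' : is_derive t 1 (fun t => eps * expR (- (2 * t)) / mu)
    (- 2 * (eps * expR (- (2 * t))) / mu).
  by apply: is_derive_eq; rewrite /GRing.scale/=; ring.
by case: i => [|[|[|i]]]; case: j => [|[|[|j]]]; case: k => [|[|[|k]]];
   first [exact: dE'|exact: dF'|exact: is_derive_cst].
Qed.

Lemma gs_metric_sym p : (gs_metric eps mu p)^T = gs_metric eps mu p.
Proof. exact: tr_diag_mx. Qed.

Lemma gs_metric_unit p : gs_metric eps mu p \in unitmx.
Proof.
rewrite unitmxE det_diag unitfE prodf_seq_neq0; apply/allP => i _ /=.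
by rewrite mxE; elim/forall_ord3: i; rewrite //= mulf_neq0// gt_eqF// expR_gt0.
Qed.

Lemma differentiable_gs_metric p : differentiable (gs_metric eps mu) p.
Proof.
by rewrite gs_metricE; apply: differentiable_mx_of_t; exact: is_derive_gs_comp.
Qed.

Lemma derive_gs_metric p v :
  'D_v (gs_metric eps mu) p = v 0 2 *: mx_of_t dgs_comp p.
Proof.
by rewrite gs_metricE; apply: derive_mx_of_t; exact: is_derive_gs_comp.
Qed.

Lemma conn_gs_metric i p :
  conn_e (gs_metric eps mu) i p = mx_of_t (gs_gamma i) p.
Proof.
apply: (@conn_mx_unique _ _ _ (fun i => mx_of_t (gs_gamma i) p)).
- exact: gs_metric_sym.
- exact: gs_metric_unit.
- exact: differentiable_gs_metric.
- by move=> a b; apply/rowP => c; rewrite !mxE; move: a b c;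
    do 3!elim/forall_ord3.
move=> a; rewrite derive_gs_metric e_E gs_metricE; apply/matrixP => b c.
rewrite !mxE !sum_ord3 !mxE; move: (p 0 2) => t {p i}.
by move: a b c; do 3!elim/forall_ord3; rewrite /=; field.
Qed.

Lemma differentiable_conn_gs_metric i p :
  differentiable (conn_e (gs_metric eps mu) i) p.
Proof.
have -> : conn_e (gs_metric eps mu) i = mx_of_t (gs_gamma i).
  by apply/funext => q; rewrite conn_gs_metric.
by apply: differentiable_mx_of_t => a b t; exact: is_derive_gs_gamma.
Qed.

Lemma curv_gs_metric k i p j l : curv_mx (gs_metric eps mu) k i p j l =
  (k == 2%:R)%:R * dgs_gamma i j l (p 0 2)
  - (i == 2%:R)%:R * dgs_gamma k j l (p 0 2)
  + \sum_(m < 3) gs_gamma i j m (p 0 2) * gs_gamma k m l (p 0 2)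
  - \sum_(m < 3) gs_gamma k j m (p 0 2) * gs_gamma i m l (p 0 2).
Proof.
have CE a : conn_e (gs_metric eps mu) a = mx_of_t (gs_gamma a).
  by apply/funext => q; rewrite conn_gs_metric.
have D a b : 'D_(e_ R a) (mx_of_t (gs_gamma b) : coords R -> 'M[R]_3) p =
    (a == 2%:R)%:R *: mx_of_t (dgs_gamma b) p.
  by rewrite (derive_mx_of_t (is_derive_gs_gamma b)) e_E eq_sym.
rewrite /curv_mx !CE (D k i) (D i k) !mxE.
by congr (_ + _ - _); apply: eq_bigr => m _; rewrite !mxE.
Qed.

Lemma ricci_gs_metric p :
  ricci_mx (gs_metric eps mu) p =
  \matrix_(i, j) (((i == 2%:R) && (j == 2%:R))%:R * (- 2)).
Proof.
apply/matrixP => i j; rewrite !mxE.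
under eq_bigr do rewrite curv_gs_metric.
rewrite !sum_ord3; move: (p 0 2) => t {p}.
by move: i j; do 2!elim/forall_ord3; rewrite /=; field.
Qed.

Context (A1 A2 A3 : R).

Let a : coords R := \row_i [:: A1; A2; A3]`_i.
Let M : 'M[R]_3 := diag_mx (\row_i [:: - (A3 + mu^-1); A3 - mu^-1; 0]`_i).

Let gs_fieldE : gs_field mu A1 A2 A3 = fun p => a + p *m M.
Proof.
apply/funext => p; apply/rowP => i; rewrite mul_mx_diag !mxE.
by move: i; elim/forall_ord3; rewrite /=; ring.
Qed.

Lemma smooth_gs_field : smooth_on setT (gs_field mu A1 A2 A3).
Proof. by rewrite gs_fieldE; exact: smooth_affine. Qed.

(** The dt dt entry forces the constant: the Lie derivative vanishes there, the Ricci entry is -2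
    and the metric entry is [mu]. In the other diagonal entries the [A3] of the derivative of the
    metric cancels that of the Jacobian. *)
Lemma gs_soliton p :
  soliton_eq (gs_metric eps mu) (gs_field mu A1 A2 A3) (- 2 / mu) p.
Proof.
have Xd : differentiable (gs_field mu A1 A2 A3) p.
  by rewrite gs_fieldE; exact: differentiable_affine.
apply/(soliton_eqP _ (differentiable_gs_metric p) Xd
  (differentiable_conn_gs_metric ^~ p)).
rewrite ricci_gs_metric /lie_mx derive_gs_metric gs_fieldE jacobian_affine.
rewrite gs_metricE /M mul_diag_mx tr_diag_mx mul_mx_diag.
apply/matrixP => i j; rewrite !mxE !sum_ord3 !mxE; move: (p 0 2) => t {Xd p}.
by move: i j; do 2!elim/forall_ord3; rewrite /=; field.
Qed.

Lemma gs_field_not_grad (f : coords R -> R) :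
  (forall p, differentiable f p) ->
  ~ (forall p, gs_field mu A1 A2 A3 p = grad (gs_metric eps mu) f p).
Proof.
move=> fd XE.
(* Lowering the index of the gradient by the diagonal metric. *)
have Df p i : 'D_(e_ R i) f p = (a + p *m M) 0 i * gs_comp i i (p 0 2).
  have /(congr1 (mulmx^~ (gs_metric eps mu p))) := XE p.
  rewrite /grad mulmxKV ?gs_metric_unit// gs_fieldE => /rowP/(_ i).
  rewrite gs_metricE [RHS]mxE => <-; rewrite mxE.
  rewrite (bigD1 i)//= big1 ?addr0 => [|j ji]; rewrite [X in _ * X]mxE//.
  by move: i j ji; do 2!elim/forall_ord3; rewrite //= => *; rewrite mulr0.
(* [f] grows at constant speed in the direction [t], so its other derivatives
   do not depend on [t]. *)
have fshift p : f (p + e_ R 2%:R) = f p + A3 * mu.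
  have [||b _] := @MVT_line _ _ f p (e_ R 2%:R) 1; rewrite ?ltr01//.
  rewrite scale1r mulr1 Df => /eqP; rewrite subr_eq => /eqP ->.
  rewrite addrC; congr (_ + _); congr (_ * _).
  by rewrite mul_mx_diag !mxE /= mulr0 addr0.
have Dshift p i : 'D_(e_ R i) f (p + e_ R 2%:R) = 'D_(e_ R i) f p.
  pose tr (q : coords R) := e_ R 2%:R + q *m 1%:M.
  have trE q : tr q = q + e_ R 2%:R by rewrite /tr mulmx1 addrC.
  have trd : differentiable tr p by exact: differentiable_affine.
  have := derive_chain (e_ R i) trd (fd (tr p)).
  rewrite derive_affine mulmx1 -trE => <-.
  have -> : (fun q => f (tr q)) = f + cst (A3 * mu).
    by apply/funext => q; rewrite trE fshift.
  rewrite deriveD => [|//|//]; last exact: diff_derivable.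
  by rewrite derive_cst addr0.
(* Compare ['D_(e_ R i) f] at [t = 0] and [t = 1]: the field component is the same, the metric
   coefficient is not. *)
have Z (i : 'I_3) (p : coords R) : i != 2%:R -> p 0 2 = 0 ->
    gs_comp i i 1 - gs_comp i i 0 != 0 -> gs_field mu A1 A2 A3 p 0 i = 0.
  move=> i2 p2 g0; apply: (mulIf g0); rewrite mul0r mulrBr.
  have := Dshift p i; rewrite !Df mulmxDl addrA mxE.
  have -> : (e_ R 2%:R *m M) 0 i = 0.
    by rewrite mul_mx_diag mxE e_E (negPf i2) mul0r.
  have -> : (p + e_ R 2%:R) 0 2 = 1 by rewrite mxE p2 add0r e_E.
  by rewrite gs_fieldE addr0 p2 => ->; rewrite subrr.
have e0 (c : R) : c != 0 -> eps * expR c - eps * expR 0 != 0.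
  by move=> c0; rewrite -mulrBr mulf_neq0// subr_eq0 (inj_eq (@expR_inj R)).
have two0 : (2 : R) != 0 by rewrite pnatr_eq0.
have g0 : gs_comp 0 0 1 - gs_comp 0 0 0 != 0.
  by rewrite /= mulr1 mulr0 e0.
have g1 : gs_comp 1 1 1 - gs_comp 1 1 0 != 0.
  by rewrite /= mulr1 mulr0 oppr0 e0// oppr_eq0.
(* Evaluating at the origin and at a unit vector isolates the coefficients [A3 + mu^-1] and
   [A3 - mu^-1], both zero. *)
have := Z 0 0 isT (mxE _ _ _ _) g0; rewrite !mxE /= => X00.
have := Z 0 (e_ R 0) isT (e_E _ _ _) g0; rewrite mxE e_E /= => X01.
have := Z 1 0 isT (mxE _ _ _ _) g1; rewrite !mxE /= => X10.
have := Z 1 (e_ R 1) isT (e_E _ _ _) g1; rewrite mxE (e_E R 1 1) /= => X11.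
have /eqP : mu^-1 = 0 by lra.
by rewrite invr_eq0 (negPf mu0).
Qed.

End GsMetric.

(** * Manifolds with a global chart *)

(** The composite is prescribed only near [x], as coordinate changes compose only on overlaps of
    charts. *)
Lemma jacobian_comp (R : realType) n m l (f : 'rV[R]_n -> 'rV[R]_m)
    (g : 'rV[R]_m -> 'rV[R]_l) (h : 'rV[R]_n -> 'rV[R]_l) x :
  differentiable f x -> differentiable g (f x) ->
  (\forall y \near x, g (f y) = h y) ->
  'J h x = 'J f x *m 'J g (f x).
Proof.
move=> fd gd gfh; have gfd : differentiable (g \o f) x.
  exact: differentiable_comp fd gd.
have hd : differentiable h x by apply: near_eq_differentiable gfd.
apply/row_matrixP => i; rewrite row_mul !rowE.
rewrite -(deriveEjacobian _ hd) -(deriveEjacobian _ fd) -(deriveEjacobian _ gd).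
rewrite -derive_chain//; apply: near_eq_derive.
by move: gfh; apply: filterS => y ->.
Qed.

Lemma Ck_on_mulmx (R : realType) (V : normedModType R) k (U : set V) m n p
    (F : V -> 'M[R]_(m, n)) (G : V -> 'M[R]_(n, p)) : open U ->
  Ck_on k U F -> Ck_on k U G -> Ck_on k U (fun x => F x *m G x).
Proof.
move=> oU /(Ck_on_mxP _ _ oU) FC /(Ck_on_mxP _ _ oU) GC.
apply/(Ck_on_mxP _ _ oU) => i j.
have -> : (fun x => (F x *m G x) i j) = (fun x => \sum_l F x i l * G x l j).
  by apply/funext => x; rewrite mxE.
by apply: Ck_on_sum => // l; apply: Ck_onM.
Qed.

Lemma Ck_on_comp_mx (R : realType) (V : normedModType R) k n m p (U : set V)
    (U' : set 'rV[R]_n) (phi : V -> 'rV[R]_n) (F : 'rV[R]_n -> 'M[R]_(m, p)) :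
  open U -> open U' -> (forall x, U x -> U' (phi x)) ->
  Ck_on k U phi -> Ck_on k U' F -> Ck_on k U (fun x => F (phi x)).
Proof.
move=> oU oU' UU' phiC /(Ck_on_mxP _ _ oU') FC; apply/(Ck_on_mxP _ _ oU) => i j.
exact: (Ck_on_comp oU UU' phiC (FC i j)).
Qed.

Section GlobalChart.
Context {R : realType} (M : pseudo_riemannian3 R) (c : chart R M).
Context (ac : atlas c) (cT : cdom c = setT) (iT : cimg c = setT).

Let phi (c' : chart R M) := local_rep id c' c.
Let psi (c' : chart R M) := local_rep id c c'.
Let D (c' : chart R M) : set (coords R) := [set z | cdom c' (cinv c z)].

Let oD c' : open (D c').
Proof.
have /continuousP cc : continuous (cinv c).
  have := @cinv_cont _ _ c; rewrite iT continuous_open_subspace;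
    last exact: openT.
  by move=> H z; apply: H; rewrite inE.
exact: cc (@cdom_open _ _ c').
Qed.

Let phi_dom c' x : cimg c' x -> D c' (phi c' x).
Proof.
move=> hx; rewrite /D/= /phi /local_rep/= cmapK ?cT//; exact: cinv_in.
Qed.

Let phiK c' x : cimg c' x -> psi c' (phi c' x) = x.
Proof.
by move=> hx; rewrite /psi /phi /local_rep/= cmapK ?cT// cinvK.
Qed.

Let phi_smooth c' : atlas c' -> smooth_on (cimg c') (phi c').
Proof.
move=> ac'; have [+ _] := atlas_compatible ac' ac.
move=> S k; apply: Ck_onS (S k) => x hx; split=> //.
by rewrite cT.
Qed.

Let psi_smooth c' : atlas c' -> smooth_on (D c') (psi c').
Proof.
move=> ac'; have [+ _] := atlas_compatible ac ac'.
move=> S k; apply: Ck_onS (S k) => x hx; split=> //.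
by rewrite iT.
Qed.

Let K c' (x : coords R) : 'M[R]_3 := 'J (psi c') (phi c' x).

Let phid c' x : atlas c' -> cimg c' x -> differentiable (phi c') x.
Proof. by move=> ac' hx; have [+ _] := Ck_onE (phi_smooth ac' 1); apply. Qed.

Let psid c' z : atlas c' -> D c' z -> differentiable (psi c') z.
Proof. by move=> ac' hz; have [+ _] := Ck_onE (psi_smooth ac' 1); apply. Qed.

(** Chain rule for [psi c'] after [phi c']; the identity is written as an affine map to reuse
    [jacobian_affine]. *)
Let JK c' x : atlas c' -> cimg c' x -> 'J (phi c') x *m K c' x = 1%:M.
Proof.
move=> ac' hx; rewrite -(jacobian_comp (h := fun y => 0 + y *m 1%:M)).
- exact: jacobian_affine.
- exact: phid.
- exact: psid (phi_dom hx).
- apply: open_near (@cimg_open _ _ c') hx _ => y hy.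
  by rewrite phiK// mulmx1 add0r.
Qed.

Let KC c' k : atlas c' -> Ck_on k (cimg c') (K c').
Proof.
move=> ac'; have JC := Ck_on_jacobian (@oD c') (psi_smooth ac' k.+1).
exact: (Ck_on_comp_mx (@cimg_open _ _ c') (@oD c') (@phi_dom c')
  (phi_smooth ac' k) JC).
Qed.

Definition spread_field (X : vfield R) (c' : chart R M) : vfield R :=
  fun x => X (phi c' x) *m K c' x.

Lemma spread_field_smooth X : smooth_on setT X -> vector_field (spread_field X).
Proof.
move=> XC; split=> [c' ac' k|c' c'' ac' ac'' x [hx hx']].
  apply: (Ck_on_mulmx (@cimg_open _ _ c')); last exact: KC.
  exact: (Ck_on_comp_mx (@cimg_open _ _ c') openT (fun _ _ => I)
    (phi_smooth ac' k) (XC k)).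
have phiE : phi c'' (local_rep id c' c'' x) = phi c' x.
  by rewrite /phi /local_rep/= cmapK.
rewrite /spread_field phiE -mulmxA; congr (_ *m _); rewrite /K phiE.
(* Near [phi c' x], [psi c''] is [psi c'] followed by the transition map, whose Jacobian must be
   taken at [x = psi c' (phi c' x)]. *)
have E := phiK hx; rewrite -{3}E; apply: jacobian_comp.
- exact: psid (phi_dom hx).
- rewrite E; have [+ _] := atlas_compatible ac' ac''.
  by move=> /(_ 1)/Ck_onE[+ _]; apply.
- apply: open_near (@oD c') (phi_dom hx) _ => z hz.
  by rewrite /psi /local_rep/= cmapK.
Qed.

(** Metric compatibility with [c] makes the metric of any chart [c'] the pullback of [gs_metric]
    along [phi c']. *)
Lemma soliton_of_global_chart eps mu X lambda : eps != 0 -> mu != 0 ->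
  (forall x, metric c x = gs_metric eps mu x) ->
  smooth_on setT X ->
  (forall y, soliton_eq (gs_metric eps mu) X lambda y) -> ricci_soliton M.
Proof.
move=> eps0 mu0 gE XC S; exists (spread_field X); split.
  exact: spread_field_smooth.
exists lambda => c' x ac' hx.
apply: (@soliton_eq_pullback R (cimg c') (phi c') (K c') (gs_metric eps mu)).
- exact: cimg_open.
- exact: phi_smooth.
- by move=> y hy; have [+ _] := Ck_onE (KC 1 ac'); apply.
- by move=> y hy; exact: JK.
- exact: gs_metric_sym.
- exact: gs_metric_unit.
- exact: differentiable_gs_metric.
- by move=> i y; exact: differentiable_conn_gs_metric.
- move=> y hy; rewrite -gE; apply: metric_compatible => //.
  by split=> //; rewrite cT.
- by move=> y; have [+ _] := Ck_onE (XC 1%N); apply.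
- by [].
- exact: hx.
- exact: S.
Qed.

End GlobalChart.

Theorem theorem1 (R : realType) :
  (cerny_kowalski_classification R ->
   forall M : pseudo_riemannian3 R,
     proper_generalized_symmetric M -> ricci_soliton M) /\
  (forall eps mu : R, (eps = 1 \/ eps = -1) -> mu != 0 ->
   forall A1 A2 A3 : R,
     [/\ smooth_on setT (gs_field mu A1 A2 A3),
         (exists lambda : R, forall p : 'rV[R]_3,
            soliton_eq (gs_metric eps mu) (gs_field mu A1 A2 A3) lambda p) &
         ~ (exists f : 'rV[R]_3 -> R,
              smooth_on setT f /\
              forall p : 'rV[R]_3,
                gs_field mu A1 A2 A3 p = grad (gs_metric eps mu) f p)]).
Proof.
have unit_neq0 (eps : R) : eps = 1 \/ eps = -1 -> eps != 0.
  by case=> ->; rewrite ?oppr_eq0 oner_neq0.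
split=> [CK M /CK[eps [mu [/unit_neq0 eps0 mu0 [c [ac cT iT gE]]]]]|].
  (* Any member of the family of fields would serve; the one with all three constants zero is
     taken. *)
  exact: (soliton_of_global_chart ac cT iT eps0 mu0 gE
    (smooth_gs_field mu 0 0 0) (gs_soliton eps0 mu0 0 0 0)).
move=> eps mu /unit_neq0 eps0 mu0 A1 A2 A3; split.
- exact: smooth_gs_field.
- by exists (- 2 / mu) => p; exact: gs_soliton.
- move=> [f [fC]]; apply: gs_field_not_grad => // p.
  by have [+ _] := Ck_onE (fC 1%N); apply.
Qed.
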